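(* Let $S=\mathbb R^d\times\mathbb R^+$ be an $ax+b$-group. For all $q\in(1,\infty)$ we have $H^{1,q}=H^{1,\infty}$, and the norms $\|\cdot\|_{H^{1,q}}$ and $\|\cdot\|_{H^{1,\infty}}$ are equivalent.
   Context: **$ax+b$-groups.** $S=\mathbb R^d\times\mathbb R^+$ ($d\ge1$) with product $(x,a)(x',a')=(x+a^{1/2}x',aa')$ and right Haar measure $d\rho(x,a)=a^{-1}\,dx\,da$. **Admissible sets.** For $k\in\mathbb Z$, $m\in\mathbb Z^d$ let $Q^k_m=\prod_{i=1}^d(m_i2^k,(m_i+1)2^k)$ be the dyadic cubes of $\mathbb R^d$. Fix a constant $\beta>1+\log2$. A set $Q^k_m\times(a_0/r,a_0r)$ with $a_0>0$, $r>1$, is admissible if $$a_0^{1/2}r^\beta\le2^k<a_0^{1/2}r^{4\beta}\ \text{ if } r\ge\mathrm e,\qquad a_0^{1/2}\log r\le2^k<\mathrm e^{4\beta}a_0^{1/2}\log r\ \text{ if }1<r<\mathrm e .$$ **Hardy spaces.** For $1<q<\infty$, a $(1,q)$-atom is a function $a\in L^1(\rho)$ supported in an admissible set $R$ with $\big(\frac1{\rho(R)}\int_R|a|^q\,d\rho\big)^{1/q}\le\rho(R)^{-1}$ and $\int_Sa\,d\rho=0$. A $(1,\infty)$-atom is a function $a\in L^1(\rho)$ supported in an admissible set $R$ with $\|a\|_\infty\le\rho(R)^{-1}$ and $\int_Sa\,d\rho=0$. For $1<q\le\infty$, $H^{1,q}$ is the space of all $f\in L^1(\rho)$ of the form $f=\sum_j\lambda_ja_j$,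 with $a_j$ $(1,q)$-atoms and $\lambda_j\in\mathbb C$, $\sum_j|\lambda_j|<\infty$; $\|f\|_{H^{1,q}}$ is the infimum of $\sum_j|\lambda_j|$ over all such decompositions. *)

(* Defs.v *)
From HB Require Import structures.
From mathcomp Require Import all_boot all_order all_algebra.
From mathcomp Require Import all_classical all_reals all_analysis.
From mathcomp Require Import measurable_realfun complex.
Import Order.TTheory GRing.Theory Num.Theory.
Import numFieldNormedType.Exports.

Set Implicit Arguments.
Unset Strict Implicit.
Unset Printing Implicit Defensive.

Local Open Scope classical_set_scope.
Local Open Scope ring_scope.

Definition cons_pair (R : realType) d
    (z : measurableTypeR R * d.-tuple (measurableTypeR R)) :
    d.+1.-tuple (measurableTypeR R) :=
  [tuple of z.1 :: z.2].

Lemma measurable_cons_pair (R : realType) d :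
  measurable_fun setT (@cons_pair R d).
Proof. exact: measurable_cons. Qed.

(* Lebesgue measure on the Borel sets of R^d, one coordinate at a time.
   measurableTypeR R is R with the Borel structure on which lebesgue_measure
   is declared as a measure. *)
Fixpoint lebesgue_tuple (R : realType) (d : nat) :
    set (d.-tuple (measurableTypeR R)) -> \bar R :=
  match d with
  | 0 => dirac [tuple]
  | d'.+1 => pushforward (lebesgue_measure \x @lebesgue_tuple R d')%E
                         (@cons_pair R d')
  end.
Arguments lebesgue_tuple {R} d.

Section lebesgue_tuple_step.
Context (R : realType) (d : nat).
Variable m : {sigma_finite_measure set (d.-tuple (measurableTypeR R)) -> \bar R}.

Definition lebesgue_tuple_step :=
  pushforward (lebesgue_measure \x m)%E (@cons_pair R d).
Local Notation mu := lebesgue_tuple_step.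

Let mcons := @measurable_cons_pair R d.

Let mu0 : mu set0 = 0%E. Proof.
by rewrite /mu /pushforward preimage_set0 measure0.
Qed.

Let mu_ge0 A : (0 <= mu A)%E. Proof. exact: measure_ge0. Qed.

Let mu_sigma_additive : semi_sigma_additive mu.
Proof. exact: measure_semi_sigma_additive. Qed.

HB.instance Definition _ :=
  isMeasure.Build _ _ _ mu mu0 mu_ge0 mu_sigma_additive.

Let mu_sigma_finite : sigma_finite setT mu.
Proof.
have /sigma_finiteP[F [FT ndF Foo]] := sigma_finiteT (@lebesgue_measure R).
have /sigma_finiteP[G [GT ndG Goo]] := sigma_finiteT m.
pose uncons (x : d.+1.-tuple (measurableTypeR R)) :
    measurableTypeR R * d.-tuple (measurableTypeR R) :=
  (thead x, [tuple of behead x]).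
have muncons : measurable_fun setT uncons.
  apply/measurable_fun_pair; last exact: measurable_behead.
  exact: measurable_tnth.
have consK : cancel (@cons_pair R d) uncons.
  by case=> t x; congr (_, _); apply: val_inj.
exists (fun i => uncons @^-1` (F i `*` G i)) => [|i].
  apply/esym; rewrite -subTset => x _.
  have [[i _ Fi] [j _ Gj]] : (\bigcup_i F i) (uncons x).1 /\
      (\bigcup_i G i) (uncons x).2 by rewrite -FT -GT.
  exists (maxn i j) => //; split.
    by move: Fi; exact/subsetPset/ndF/leq_maxl.
  by move: Gj; exact/subsetPset/ndG/leq_maxr.
have [mF Fi] := Foo i; have [mG Gi] := Goo i; split.
  by rewrite -[X in measurable X]setTI; apply: muncons => //; exact: measurableX.
rewrite /lebesgue_tuple_step /pushforward -comp_preimage.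
have -> : uncons \o @cons_pair R d = id by apply/funext => z; exact: consK.
rewrite preimage_id product_measure1E// lte_mul_pinfty// ge0_fin_numE//.
Qed.

HB.instance Definition _ :=
  Measure_isSigmaFinite.Build _ _ _ mu mu_sigma_finite.

End lebesgue_tuple_step.

Section lebesgue_tuple_measure.
Context (R : realType) (d : nat).

Let lebesgue_tuple_packed :
  exists m : {sigma_finite_measure set (d.-tuple (measurableTypeR R)) -> \bar R},
    lebesgue_tuple d = m.
Proof.
elim: d => [|n [m mE]].
  by exists (dirac ([tuple] : 0.-tuple (measurableTypeR R))).
by exists (lebesgue_tuple_step m); rewrite /= mE.
Qed.

Let mu0 : lebesgue_tuple d set0 = 0%E :> \bar R.
Proof. by have [m ->] := lebesgue_tuple_packed; exact: measure0. Qed.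

Let mu_ge0 A : (0 <= lebesgue_tuple d A :> \bar R)%E.
Proof. by have [m ->] := lebesgue_tuple_packed; exact: measure_ge0. Qed.

Let mu_sigma_additive : semi_sigma_additive (@lebesgue_tuple R d).
Proof.
have [m ->] := lebesgue_tuple_packed; exact: measure_semi_sigma_additive.
Qed.

HB.instance Definition _ := isMeasure.Build _ _ _
  (@lebesgue_tuple R d) mu0 mu_ge0 mu_sigma_additive.

Let mu_sigma_finite : sigma_finite setT (@lebesgue_tuple R d).
Proof. have [m ->] := lebesgue_tuple_packed; exact: sigma_finiteT. Qed.

HB.instance Definition _ := Measure_isSigmaFinite.Build _ _ _
  (@lebesgue_tuple R d) mu_sigma_finite.

End lebesgue_tuple_measure.

(* The group S = R^d x ]0, +oo[, with (x, a) (x', a') = (x + sqrt a x', a a'),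
   is handled inside R^d x R: its right Haar measure a^-1 dx da is extended by
   0 to the complement of S.  A function on S is thus a function on R^d x R
   considered up to rho-a.e. equality. *)
Notation axb_space R d :=
  (d.-tuple (measurableTypeR R) * measurableTypeR R)%type.

Section haar_measure.
Context (R : realType) (d : nat).
Local Open Scope ereal_scope.

Definition axb_group : set (axb_space R d) := [set z | (0 < z.2 :> R)%R].

Definition rho (A : set (axb_space R d)) : \bar R :=
  \int[lebesgue_tuple d \x lebesgue_measure]_(z in A `&` axb_group)
    ((z.2 : R)^-1)%:E.

Lemma measurable_axb_group : measurable axb_group.
Proof.
rewrite (_ : axb_group = setT `*` `]0%R, +oo[%classic).
  exact: measurableX.
by apply/seteqP; split=> z /=; rewrite in_itv/= andbT => // -[].
Qed.

Let measurable_density :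
  measurable_fun axb_group (fun z : axb_space R d => (z.2 : R)^-1)%R.
Proof.
apply: (eq_measurable_fun (fun z : axb_space R d => (z.2 : R) `^ (-1))%R).
  by move=> z; rewrite inE => z0; rewrite powR_inv1// ltW.
apply: measurable_funTS.
exact: (measurableT_comp (measurable_powR (-1)) measurable_snd).
Qed.

Let rho0 : rho set0 = 0.
Proof. by rewrite /rho set0I integral_set0. Qed.

Let rho_ge0 A : 0 <= rho A.
Proof.
by apply: integral_ge0 => z [_ z0]; rewrite lee_fin invr_ge0 ltW.
Qed.

Let rho_sigma_additive : semi_sigma_additive rho.
Proof.
move=> F mF tF mUF; have mS := measurable_axb_group.
apply: cvg_toP.
  apply: ereal_nondecreasing_is_cvgn => m n mn.
  by apply: lee_sum_nneg_natr => // k _ _; exact: rho_ge0.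
rewrite /rho setI_bigcupl ge0_integral_bigcup//=.
- by move=> k; exact: measurableI.
- apply/measurable_EFinP; apply: (measurable_funS mS).
    by move=> z [k _ []].
  exact: measurable_density.
- by move=> z [k _ [_ z0]]; rewrite lee_fin invr_ge0 ltW.
- exact: trivIset_setIr.
Qed.

HB.instance Definition _ := isMeasure.Build _ _ _
  rho rho0 rho_ge0 rho_sigma_additive.

End haar_measure.
Arguments rho {R d}.

Section hardy_space.
Context (R : realType) (d : nat).
Implicit Types (f a : axb_space R d -> R[i]) (Q : set (axb_space R d)).

Definition dyadic_cube (k : int) (m : d.-tuple int) :
    set (d.-tuple (measurableTypeR R)) :=
  [set x | forall i : 'I_d,
     (tnth m i)%:~R * 2 ^ k < (tnth x i : R) < ((tnth m i)%:~R + 1) * 2 ^ k].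

Definition admissible (beta : R) Q : Prop :=
  exists (k : int) (m : d.-tuple int) (a0 r : R),
    [/\ 0 < a0, 1 < r,
      Q = dyadic_cube k m `*` `]a0 / r, a0 * r[
    & if expR 1 <= r then
        Num.sqrt a0 * r `^ beta <= 2 ^ k < Num.sqrt a0 * r `^ (4 * beta)
      else
        Num.sqrt a0 * ln r <= 2 ^ k < expR (4 * beta) * Num.sqrt a0 * ln r].

Local Notation cmod := (@ComplexField.Normc.normc R).

Definition L1 f : Prop :=
  rho.-integrable setT (EFin \o (fun z => complex.Re (f z))) /\
  rho.-integrable setT (EFin \o (fun z => complex.Im (f z))).

Definition cintegral f : R[i] :=
  Complex (\int[rho]_z complex.Re (f z)) (\int[rho]_z complex.Im (f z)).

Definition atom_size (q : \bar R) Q a : Prop :=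
  match q with
  | p%:E => (((rho Q)^-1 * \int[rho]_(z in Q) (cmod (a z) `^ p)%:E) `^ p^-1
              <= (rho Q)^-1)%E
  | +oo%E => ('N[rho]_+oo[EFin \o (cmod \o a)] <= (rho Q)^-1)%E
  | -oo%E => False
  end.

(* Elements of L^1(rho) are classes modulo rho-a.e. equality, so the support
   condition is an a.e. condition as well. *)
Definition atom (beta : R) (q : \bar R) a : Prop :=
  L1 a /\ exists Q, [/\ admissible beta Q,
    {ae rho, forall z, ~ Q z -> a z = 0},
    atom_size q Q a & cintegral a = 0].

(* f = \sum_j lambda_j a_j in L^1(rho) *)
Definition atomic_decomposition (beta : R) (q : \bar R) f
    (lambda : nat -> R[i]) (b : nat -> axb_space R d -> R[i]) : Prop :=
  [/\ forall j, atom beta q (b j),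
    (\sum_(0 <= j <oo) (cmod (lambda j))%:E < +oo)%E
  & (fun n => \int[rho]_z (cmod (f z - \sum_(j < n) lambda j * b j z))%:E)%E
      @ \oo --> 0%E].

Definition H1 (beta : R) (q : \bar R) : set (axb_space R d -> R[i]) :=
  [set f | L1 f /\ exists lambda b, atomic_decomposition beta q f lambda b].

(* +oo outside of H1 beta q, as the infimum of the empty set *)
Definition H1_norm (beta : R) (q : \bar R) f : \bar R :=
  ereal_inf [set s | exists lambda b, atomic_decomposition beta q f lambda b /\
    s = (\sum_(0 <= j <oo) (cmod (lambda j))%:E)%E].

End hardy_space.
Arguments H1 {R} d beta q.

(* Main.v *)
Require Import Defs.
From mathcomp Require Import all_boot all_order all_algebra.
From mathcomp Require Import all_classical all_reals all_analysis.
From mathcomp Require Import measurable_realfun ess_sup_inf complex ring lra zify.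
From Stdlib Require List.
Import Order.TTheory GRing.Theory Num.Theory.
Import numFieldNormedType.Exports HBNNSimple.

Set Implicit Arguments.
Unset Strict Implicit.
Unset Printing Implicit Defensive.

Local Open Scope classical_set_scope.
Local Open Scope ring_scope.

(* An admissible set can be cut into 2^d admissible halves of its cube, or, when
   its cube is too small for that, into the two halves of its interval in the
   variable log a.  Iterating gives a tree of admissible cells, with bounded
   ratios of masses, on which the Calderon-Zygmund stopping-time argument runs.
   It is stopped after finitely many generations, so a (1,q)-atom is a
   combination of (1,oo)-atoms with bounded weight plus its deviation from the
   averages over the last generation of cells.  As cells shrink, that deviation
   tends to 0 in L^q, and it is a combination of (1,q)-atoms with weight at most
   1/2.  Applying this repeatedly to what remains turns a (1,q)-decomposition
   into a (1,oo)-decomposition, and no almost everywhere convergence of averages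
   is needed. *)

(** The bound on the weight of the (1,oo)-part must not depend on the number of generations, because
    the number that makes the deviation of a given atom small comes with no rate. Uniformity comes
    from heights that grow geometrically along stopped cells. Smallness is qualitative: the sets
    whose indicators are approximated by averages over cells form a sigma-algebra containing the
    coordinate half-spaces, and L^q functions follow through simple functions. For the half-spaces
    the cells must shrink in all directions; admissibility ties the side of the cube to the length
    of the interval, so neither can be cut forever alone. The natural weight of a remainder on a
    cell, a product of powers of its mass and of its q-th energy, does not add up over cells. A
    bound with a free parameter [tau] replaces it by an expression linear in both; [tau] is fixed
    first, the number of generations afterwards. Atoms are complex and admissible sets open, whereas
    the trees carry real functions on half-open cells that partition exactly. The passage costs a
    factor 2, for real and imaginary parts, and a null set. *)

Section powR_inequalities.
Context {R : realType}.
Implicit Types x y s q : R.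

(* x is compared with the tangent at s of the convex function x |-> x `^ q. *)
Lemma powR_tangent q s x : 1 < q -> 0 < s -> 0 <= x ->
  x <= (1 - q^-1) * s + q^-1 * (s `^ (1 - q) * x `^ q).
Proof.
move=> q1 s0 x0; have q0 : 0 < q by lra.
have qV1 : q^-1 < 1 by rewrite invf_lt1.
have p0 : 0 < (1 - q^-1)^-1 by rewrite invr_gt0; lra.
(* Young's inequality; the powers of [s] cancel in the product of the two factors, which leaves
   [x]. *)
have := @conjugate_powR R (x * s `^ ((1 - q) / q)) (s `^ (1 - q^-1)) q
  (1 - q^-1)^-1.
rewrite mulr_ge0 ?powR_ge0// => /(_ isT isT q0 p0).
rewrite invrK addrC subrK => /(_ erefl).
rewrite -mulrA -powRD; last by rewrite (gt_eqF s0) implybT.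
have -> : (1 - q) / q + (1 - q^-1) = 0 by field; lra.
rewrite powRr0 mulr1 powRM ?powR_ge0// -!powRrM mulfVK ?gt_eqF// mulfV; last lra.
rewrite (powRr1 (ltW s0)) => h; apply: (le_trans h).
by rewrite addrC (mulrC s) lerD2l mulrC (mulrC (s `^ _)).
Qed.

Lemma le_powR_onem q s x : 1 <= q -> 0 < s -> s <= x ->
  x `^ (1 - q) <= s `^ (1 - q).
Proof.
move=> q1 s0 sx; have x0 : 0 < x by apply: lt_le_trans sx.
rewrite -opprB !powRN lef_pV2 ?posrE ?powR_gt0//.
by apply: ge0_ler_powR; rewrite ?nnegrE ?subr_ge0// ltW.
Qed.

(** Let [y] be the q-th root of [x]. Either [y <= tau], or [y] exceeds [tau] and then
    [y = y ^ (1 - q) * x <= tau ^ (1 - q) * x]. This bounds a root by an expression affine in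
    [x]. *)
Lemma powR_dichotomy q tau x : 1 <= q -> 0 < tau -> 0 <= x ->
  x <= (tau + tau `^ (1 - q) * x) `^ q.
Proof.
move=> q1 t0 x0; have q0 : 0 < q by apply: lt_le_trans q1.
pose y := x `^ q^-1.
have y0 : 0 <= y by exact: powR_ge0.
have yq : y `^ q = x by rewrite -powRrM mulVf ?gt_eqF// powRr1.
rewrite -[leLHS]yq; apply: ge0_ler_powR; rewrite ?nnegrE//.
- exact: ltW.
- by rewrite addr_ge0 ?mulr_ge0 ?powR_ge0// ltW.
have [yt|ty] := leP y tau.
  by rewrite (le_trans yt)// lerDl mulr_ge0// powR_ge0.
have yp : 0 < y by apply: lt_trans ty.
apply: (@le_trans _ _ (tau `^ (1 - q) * x)); last by rewrite lerDr ltW.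
apply: (@le_trans _ _ (y `^ (1 - q) * x)).
  by rewrite -yq -powRD ?(gt_eqF yp) ?implybT// subrK powRr1.
by rewrite ler_wpM2r// le_powR_onem// ltW.
Qed.

Lemma normr_powRD q x y : 0 < q ->
  `|x + y| `^ q <= 2 `^ q * (`|x| `^ q + `|y| `^ q).
Proof.
move=> q0.
have H (a b : R) : `|a| <= `|b| -> `|a + b| `^ q <= 2 `^ q * `|b| `^ q.
  move=> ab; rewrite -powRM//.
  apply: ge0_ler_powR; rewrite ?nnegrE ?mulr_ge0 ?(ltW q0)//.
  by apply: (le_trans (ler_normD _ _)); lra.
have [xy|/ltW yx] := leP `|x| `|y|.
  apply: (le_trans (H _ _ xy)).
  by rewrite ler_wpM2l ?powR_ge0// lerDr powR_ge0.
rewrite addrC; apply: (le_trans (H _ _ yx)).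
by rewrite ler_wpM2l ?powR_ge0// lerDl powR_ge0.
Qed.

(** Makes q-integrable functions supported on a set of finite measure integrable. *)
Lemma le_D1_powR q x : 1 <= q -> 0 <= x -> x <= 1 + x `^ q.
Proof.
move=> q1 x0; have [x1|/ltW x1] := leP x 1.
  by rewrite (le_trans x1)// lerDl powR_ge0.
by rewrite (le_trans (le1r_powR x1 q1))// lerDr.
Qed.

Lemma cvg_normr_powR0 q (x_ : nat -> R) : 0 < q ->
  x_ n @[n --> \oo] --> 0 -> `|x_ n| `^ q @[n --> \oo] --> 0.
Proof.
move=> q0 /cvgr0Pnorm_le x0; apply/cvgr0Pnorm_le => e e0.
near=> n; rewrite ger0_norm ?powR_ge0//.
have -> : e = (e `^ q^-1) `^ q by rewrite -powRrM mulVf ?gt_eqF// powRr1 ?ltW.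
apply: ge0_ler_powR; rewrite ?nnegrE ?powR_ge0 ?(ltW q0)//.
by near: n; apply: x0; rewrite powR_gt0.
Unshelve. all: by end_near.
Qed.

End powR_inequalities.

(** * Real-valued integrals over the whole space *)

Section real_integral.
Context {d} {T : measurableType d} {R : realType}.
Variable mu : {measure set T -> \bar R}.
Implicit Types (f g u : T -> R) (A D : set T).

Definition intble f := mu.-integrable setT (EFin \o f).

Definition Int f : R := \int[mu]_x f x.

Lemma intble_measurable f : intble f -> measurable_fun setT f.
Proof. by move/(measurable_int mu)/measurable_EFinP. Qed.

Lemma intbleD f g : intble f -> intble g -> intble (f \+ g).
Proof. exact: integrableD. Qed.

Lemma intbleZ c f : intble f -> intble (fun x => c * f x).
Proof. exact: integrableZl. Qed.

Lemma intbleB f g : intble f -> intble g -> intble (f \- g).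
Proof. exact: integrableB. Qed.

Lemma intble0 : intble (fun=> 0).
Proof. exact: integrable0. Qed.

Lemma intble_norm f : intble f -> intble (fun x => `|f x|).
Proof. exact: integrable_norm. Qed.

Lemma le_intble f g : measurable_fun setT f -> (forall x, `|f x| <= g x) ->
  intble g -> intble f.
Proof.
move=> mf fg; apply: le_integrable => //; first exact/measurable_EFinP.
by move=> x _ /=; rewrite lee_fin (le_trans (fg x))// ler_norm.
Qed.

Lemma intble_indic A : measurable A -> (mu A < +oo)%E -> intble \1_A.
Proof.
move=> mA Aoo; apply/integrableP; split; first exact/measurable_EFinP.
under eq_integral do rewrite /= ger0_norm//.
by rewrite integral_indic// setIT.
Qed.

Lemma measurable_funM_indic f A : measurable A -> measurable_fun setT f ->
  measurable_fun setT (fun x => f x * \1_A x).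
Proof. by move=> mA mf; apply: measurable_funM. Qed.

Lemma intbleM_indic f A : measurable A -> intble f ->
  intble (fun x => f x * \1_A x).
Proof.
move=> mA If; apply: (@le_intble _ (fun x => `|f x|)).
- exact/measurable_funM_indic/intble_measurable.
- move=> x; rewrite normrM ler_piMr// indicE ger0_norm//.
  by case: (_ \in _); rewrite ?lexx ?ler01.
- exact: intble_norm.
Qed.

Lemma IntD f g : intble f -> intble g -> Int (f \+ g) = Int f + Int g.
Proof. exact: RintegralD. Qed.

Lemma IntB f g : intble f -> intble g -> Int (f \- g) = Int f - Int g.
Proof. exact: RintegralB. Qed.

Lemma IntZ c f : intble f -> Int (fun x => c * f x) = c * Int f.
Proof. exact: RintegralZl. Qed.

Lemma Int0 : Int (fun=> 0) = 0.
Proof. by rewrite /Int Rintegral_cst// mul0r. Qed.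

Lemma Int_ge0 f : (forall x, 0 <= f x) -> 0 <= Int f.
Proof. by move=> f0; apply: Rintegral_ge0. Qed.

Lemma le_Int f g : intble f -> intble g -> (forall x, f x <= g x) ->
  Int f <= Int g.
Proof. by move=> If Ig fg; apply: le_Rintegral. Qed.

Lemma le_norm_Int f : intble f -> `|Int f| <= Int (fun x => `|f x|).
Proof. exact: le_normr_Rintegral. Qed.

Lemma Int_indic A : measurable A -> Int \1_A = fine (mu A).
Proof. by move=> mA; rewrite /Int /Rintegral integral_indic// setIT. Qed.

Lemma intble_sum I (s : seq I) (F : I -> T -> R) :
  (forall i, intble (F i)) -> intble (fun x => \sum_(i <- s) F i x).
Proof.
move=> IF; elim: s => [|i s IH].
  by under eq_fun do rewrite big_nil; exact: intble0.
by under eq_fun do rewrite big_cons; exact: intbleD.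
Qed.

Lemma Int_sum I (s : seq I) (F : I -> T -> R) :
  (forall i, intble (F i)) ->
  Int (fun x => \sum_(i <- s) F i x) = \sum_(i <- s) Int (F i).
Proof.
move=> IF; elim: s => [|i s IH].
  by under eq_fun do rewrite big_nil; rewrite Int0 big_nil.
under eq_fun do rewrite big_cons.
by rewrite big_cons -IH -IntD//; exact: intble_sum.
Qed.

Lemma measurable_norm_powR f q : measurable_fun setT f ->
  measurable_fun setT (fun x => `|f x| `^ q).
Proof.
move=> mf; apply: (measurableT_comp (measurable_powR q)).
exact: measurableT_comp.
Qed.

Lemma dominated_Int_small (f : nat -> T -> R) g eps :
  (forall n, measurable_fun setT (f n)) ->
  (forall n x, 0 <= f n x <= g x) -> (forall x, f n x @[n --> \oo] --> 0) ->
  intble g -> 0 < eps -> exists n, Int (f n) <= eps.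
Proof.
move=> mf fg f0 ig e0.
have fi n : intble (f n).
  apply: le_intble (mf n) _ ig => x; have /andP[f0x fgx] := fg n x.
  by rewrite ger0_norm.
have f0' : {ae mu, forall x, setT x -> (f n x)%:E @[n --> \oo] --> 0%E}.
  by apply: aeW => x _; apply/cvg_EFin; [near=> n|exact: f0].
have fg' : {ae mu, forall x n, setT x -> (`|(f n x)%:E| <= (g x)%:E)%E}.
  by apply: aeW => x n _; have /andP[f0x fgx] := fg n x; rewrite lee_fin ger0_norm.
have [_ _] := dominated_convergence measurableT
  (fun n => (measurable_EFinP _ _).2 (mf n)) (measurable_cst _) f0' ig fg'.
rewrite integral0 => /fine_cvgP[_] /cvgrPdist_le /(_ _ e0) [n _ /(_ n (leqnn n))].
rewrite /= sub0r normrN => h; exists n.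
by rewrite (le_trans _ h)// ler_norm.
Unshelve. all: by end_near.
Qed.

End real_integral.

(** * Stopping-time decomposition on a tree of cells *)

Section combinations.
Context {R : ringType} {T : Type}.
Implicit Types l : seq (R * (T -> R)).

Definition comb l (z : T) : R := \sum_(p <- l) p.1 * p.2 z.

Lemma comb_nil z : comb [::] z = 0.
Proof. by rewrite /comb big_nil. Qed.

Lemma comb_cat l l' z : comb (l ++ l') z = comb l z + comb l' z.
Proof. by rewrite /comb big_cat. Qed.

Lemma comb_seq1 c b z : comb [:: (c, b)] z = c * b z.
Proof. by rewrite /comb big_seq1. Qed.

End combinations.

Section weights.
Context {R : realDomainType} {T : Type}.
Implicit Types l : seq (R * (T -> R)).

Definition weight l : R := \sum_(p <- l) `|p.1|.

Lemma weight_cat l l' : weight (l ++ l') = weight l + weight l'.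
Proof. by rewrite /weight big_cat. Qed.

End weights.

Section subdivision_tree.
Context {d} {T : measurableType d} {R : realType}.
Variables (mu : {measure set T -> \bar R}) (cell : choiceType).
Variables (region : cell -> set T) (children : cell -> seq cell).
Variables (ok : cell -> Prop) (B q : R).
Local Notation mass P := (fine (mu (region P))).
Local Notation ind P := (\1_(region P) : T -> R).
Local Notation Int := (Int mu).
Local Notation intble := (intble mu).
Implicit Types (u v g b : T -> R) (P C : cell).

(** The partition is expressed by indicators because integrals over a cell are integrals of products
    with its indicator. [B] bounds the growth of averages of nonnegative functions from a cell to a
    child. *)
Record subdivision : Prop := Subdivision {
  region_measurable : forall P, measurable (region P);
  region_finite : forall P, (mu (region P) < +oo)%E;
  ok_mass_gt0 : forall P, ok P -> 0 < mass P;
  ok_children : forall P C, ok P -> C \in children P -> ok C;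
  indic_children : forall P z, ok P ->
    ind P z = \sum_(C <- children P) ind C z;
  mass_children : forall P C, ok P -> C \in children P ->
    mass P <= B * mass C }.

Definition average P u : R := Int (fun z => u z * ind P z) / mass P.

Definition deviation P u : R :=
  Int (fun z => `|u z - average P u| `^ q * ind P z).

Fixpoint oscillation N P u : R :=
  if N is N'.+1 then \sum_(C <- children P) oscillation N' C u
  else deviation P u.

Definition real_ooatom b := exists2 P, ok P &
  [/\ measurable_fun setT b, forall z, `|b z| <= (mass P)^-1 * ind P z
    & Int b = 0].

(** The size condition is the usual one raised to the power [q] (see [size_condition]). The support
    condition is pointwise, not almost everywhere. *)
Definition real_qatom b := exists2 P, ok P &
  [/\ measurable_fun setT b, forall z, ~ region P z -> b z = 0,
     intble (fun z => `|b z| `^ q),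
     Int (fun z => `|b z| `^ q) <= mass P `^ (1 - q) & Int b = 0].

(** [g] is the bounded part, [l] the finished part and [l'] the remainder. [g] keeps the integral of
    [v], so that it becomes a multiple of a (1,oo)-atom once the average of [v] is subtracted, or at
    once if [v] has mean zero. The bound [M] is a function so that bounds on disjoint cells add
    up. *)
Definition decomposes v (M : T -> R) w w' := exists g l l',
  [/\ [/\ measurable_fun setT g, forall z, `|g z| <= M z & Int g = Int v],
      forall z, v z = g z + comb l z + comb l' z,
      List.Forall (fun p => real_ooatom p.2) l,
      List.Forall (fun p => real_qatom p.2) l'
    & weight l <= w /\ weight l' <= w'].

Hypotheses (S : subdivision) (B1 : 1 < B) (q1 : 1 < q).

Let q0 : 0 < q. Proof. by apply: lt_trans q1. Qed.
Let B0 : 0 < B. Proof. by apply: lt_trans B1. Qed.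

Let mR P : measurable (region P). Proof. exact: region_measurable. Qed.

Lemma ind_ge0 P z : 0 <= ind P z.
Proof. by rewrite indicE. Qed.

Lemma intble_ind P : intble (ind P).
Proof. by apply: intble_indic => //; exact: region_finite. Qed.

Lemma Int_ind P : Int (ind P) = mass P.
Proof. exact: Int_indic. Qed.

Lemma decomposes0 : decomposes (fun=> 0) (fun=> 0) 0 0.
Proof.
exists (fun=> 0), [::], [::]; split => //.
- by split => // z; rewrite normr0.
- by move=> z; rewrite !comb_nil !addr0.
- by rewrite /weight big_nil.
Qed.

Lemma decomposesD v1 v2 M1 M2 w1 w2 w1' w2' :
  intble v1 -> intble v2 -> intble M1 -> intble M2 ->
  decomposes v1 M1 w1 w1' -> decomposes v2 M2 w2 w2' ->
  decomposes (v1 \+ v2) (M1 \+ M2) (w1 + w2) (w1' + w2').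
Proof.
move=> iv1 iv2 iM1 iM2 [g1 [l1 [l1' [[mg1 gM1 Ig1] e1 o1 a1 [we1 we1']]]]].
move=> [g2 [l2 [l2' [[mg2 gM2 Ig2] e2 o2 a2 [we2 we2']]]]].
exists (g1 \+ g2), (l1 ++ l2), (l1' ++ l2'); split.
- split; first exact: measurable_funD.
    by move=> z; rewrite (le_trans (ler_normD _ _))// lerD.
  rewrite !IntD//; first by rewrite Ig1 Ig2.
    exact: le_intble gM1 _.
  exact: le_intble gM2 _.
- move=> z; rewrite /= e1 e2 !comb_cat; ring.
- exact/List.Forall_app.
- exact/List.Forall_app.
- by rewrite !weight_cat !lerD.
Qed.

Lemma decomposes_sum (s : seq cell) u (M : R) (w w' : cell -> R) :
  intble u ->
  (forall C, C \in s -> decomposes (fun z => u z * ind C z)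
     (fun z => M * ind C z) (w C) (w' C)) ->
  decomposes (fun z => u z * \sum_(C <- s) ind C z)
    (fun z => M * \sum_(C <- s) ind C z)
    (\sum_(C <- s) w C) (\sum_(C <- s) w' C).
Proof.
move=> iu; elim: s => [_|C s IH H].
  under eq_fun do rewrite big_nil mulr0.
  under [in X in decomposes _ X]eq_fun do rewrite big_nil mulr0.
  by rewrite !big_nil; exact: decomposes0.
under eq_fun do rewrite big_cons mulrDr.
under [in X in decomposes _ X]eq_fun do rewrite big_cons mulrDr.
have isum v : intble v -> intble (fun z => v z * \sum_(C <- s) ind C z).
  move=> iv; under eq_fun do rewrite big_distrr/=.
  by apply: intble_sum => D; exact: intbleM_indic.
rewrite !big_cons; apply: decomposesD.
- exact: intbleM_indic.
- exact: isum.
- exact/intbleZ/intble_ind.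
- apply: intbleZ; apply: intble_sum; exact: intble_ind.
- by apply: H; rewrite mem_head.
- by apply: IH => D Ds; apply: H; rewrite inE Ds orbT.
Qed.

Lemma ooatom_decomposition P M v : ok P -> 0 < M -> measurable_fun setT v ->
  (forall z, `|v z| <= M * ind P z) -> Int v = 0 ->
  exists l, [/\ List.Forall (fun p => real_ooatom p.2) l,
    forall z, v z = comb l z & weight l = M * mass P].
Proof.
move=> okP M0 mv vM Iv; have m0 := ok_mass_gt0 S okP.
have c0 : 0 < M * mass P by rewrite mulr_gt0.
exists [:: (M * mass P, fun z => (M * mass P)^-1 * v z)]; split.
- constructor => //; exists P => //; split => /=.
  + exact: measurable_funM.
  + move=> z; rewrite normrM ger0_norm ?invr_ge0 ?(ltW c0)//.
    by rewrite ler_pdivrMl// mulrA mulfK ?gt_eqF.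
  + rewrite IntZ ?Iv ?mulr0//.
    exact: le_intble vM (intbleZ _ (intble_ind P)).
- by move=> z; rewrite comb_seq1 mulrA mulfV ?mul1r// gt_eqF.
- by rewrite /weight big_seq1 ger0_norm// ltW.
Qed.

(** Plain normalisation would give the weight [mass P ^ (1 - 1/q)] times the q-th root of the
    integral. The present weight dominates it by [powR_dichotomy] and is linear in mass and
    integral, so it can be summed over cells. It is positive even if [v] vanishes, which allows the
    division. *)
Lemma qatom_decomposition P tau v : ok P -> 0 < tau ->
  measurable_fun setT v -> (forall z, ~ region P z -> v z = 0) ->
  intble (fun z => `|v z| `^ q) -> Int v = 0 ->
  exists l, [/\ List.Forall (fun p => real_qatom p.2) l,
    forall z, v z = comb l z
    & weight l = tau * mass P + tau `^ (1 - q) * Int (fun z => `|v z| `^ q)].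
Proof.
move=> okP t0 mv v0 iv Iv; have m0 := ok_mass_gt0 S okP.
set X := Int _; have X0 : 0 <= X by apply: Int_ge0 => z; exact: powR_ge0.
set c := _ + _; have c0 : 0 < c.
  by rewrite ltr_wpDr ?mulr_ge0 ?powR_ge0// mulr_gt0.
have iv1 : intble v.
  apply: le_intble mv _ (intbleD (intble_ind P) iv) => z /=.
  have [zP|zP] := pselect (region P z).
    by rewrite indicE mem_set// le_D1_powR// ltW.
  by rewrite v0// normr0 addr_ge0// powR_ge0.
exists [:: (c, fun z => c^-1 * v z)]; split.
- constructor => //; exists P => //.
  have E : (fun z => `|c^-1 * v z| `^ q) =
           (fun z => c^-1 `^ q * `|v z| `^ q).
    apply/funext => z; rewrite normrM powRM// (gtr0_norm (_ : 0 < c^-1))//.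
    by rewrite invr_gt0.
  split => /=.
  + exact: measurable_funM.
  + by move=> z zP; rewrite v0// mulr0.
  + by rewrite E; exact: intbleZ.
  + rewrite E IntZ// -/X.
    set x := X / mass P; have x0 : 0 <= x by rewrite divr_ge0// ltW.
    have XE : X = x * mass P by rewrite /x mulfVK ?gt_eqF.
    have cE : c = (tau + tau `^ (1 - q) * x) * mass P.
      by rewrite /c XE mulrDl mulrA.
    have -> : c^-1 `^ q = (c `^ q)^-1.
      by rewrite -(powR_inv1 (ltW c0)) -powRrM mulN1r powRN.
    rewrite ler_pdivrMl ?powR_gt0// cE powRM ?(ltW m0)//; last first.
      by rewrite addr_ge0 ?mulr_ge0 ?powR_ge0// ltW.
    rewrite -mulrA -powRD ?(gt_eqF m0) ?implybT// (addrC q) subrK (powRr1 (ltW m0)).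
    by rewrite XE ler_wpM2r ?(ltW m0)// powR_dichotomy// ltW.
  + by rewrite IntZ// Iv mulr0.
- by move=> z; rewrite comb_seq1 mulrA mulfV ?mul1r// gt_eqF.
- by rewrite /weight big_seq1 ger0_norm// ltW.
Qed.

Lemma normr_average P u : ok P -> intble u ->
  `|average P u| * mass P <= Int (fun z => `|u z| * ind P z).
Proof.
move=> okP iu; have m0 := ok_mass_gt0 S okP.
rewrite /average normrM (gtr0_norm (_ : 0 < (mass P)^-1)) ?invr_gt0//.
rewrite mulfVK ?gt_eqF//; apply: le_trans (le_norm_Int (intbleM_indic _ iu)) _ => //.
apply: le_Int => [||z]; last by rewrite normrM (ger0_norm (ind_ge0 _ _)).
  exact/intble_norm/intbleM_indic.
exact/intbleM_indic/intble_norm.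
Qed.

Lemma average_ind P : ok P -> average P (ind P) = 1.
Proof.
move=> okP; rewrite /average.
have -> : (fun z => ind P z * ind P z) = ind P.
  by apply/funext => z; rewrite indicE; case: (_ \in _); rewrite ?mulr1 ?mulr0.
by rewrite Int_ind divff// gt_eqF// (ok_mass_gt0 S okP).
Qed.

Lemma Int_normr_le P u lam : ok P -> 0 < lam -> intble u ->
  intble (fun z => `|u z| `^ q) ->
  Int (fun z => `|u z| * ind P z) <= (1 - q^-1) * (lam * mass P) +
    q^-1 * (lam `^ (1 - q) * Int (fun z => `|u z| `^ q * ind P z)).
Proof.
move=> okP l0 iu iuq.
have iI := intble_ind P.
have iU : intble (fun z => `|u z| `^ q * ind P z) by exact: intbleM_indic.
rewrite mulrA -Int_ind -!IntZ//; last exact: intbleZ.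
rewrite -IntD; [|exact: intbleZ|exact/intbleZ/intbleZ].
apply: le_Int => [||z].
- exact/intbleM_indic/intble_norm.
- by apply: intbleD; [exact: intbleZ|exact/intbleZ/intbleZ].
- rewrite /= !mulrA -mulrDl ler_wpM2r ?ind_ge0// -mulrA.
  exact: powR_tangent.
Qed.

(** A Chebyshev-type bound: the term [(1 - q^-1) * (lam * mass P)] of [Int_normr_le] is absorbed by
    the left-hand side. *)
Lemma le_mass_Int_powR P u lam : ok P -> 0 < lam -> intble u ->
  intble (fun z => `|u z| `^ q) ->
  lam * mass P <= Int (fun z => `|u z| * ind P z) ->
  lam * mass P <= lam `^ (1 - q) * Int (fun z => `|u z| `^ q * ind P z).
Proof.
move=> okP l0 iu iuq h.
have := le_trans h (Int_normr_le okP l0 iu iuq).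
by rewrite mulrBl mul1r -addrA lerDl addrC subr_ge0 ler_pM2l// invr_gt0.
Qed.

(** The solution of [A = A * B ^ (1 - q) + 2 * B ^ 2]: the recursive cost at a stopped cell, where
    the height is [B * lam], plus the cost of the correction made there. *)
Definition cz_const : R := 2 * B ^+ 2 / (1 - B `^ (1 - q)).

Local Notation A := cz_const.

Let B1q : B `^ (1 - q) < 1.
Proof.
rewrite -opprB powRN invf_lt1 ?powR_gt0//.
have : (1 : R) `^ (q - 1) < B `^ (q - 1).
  by apply: gt0_ltr_powR; rewrite ?nnegrE ?subr_gt0// ltW.
by rewrite powR1.
Qed.

Lemma cz_const_ge0 : 0 <= A.
Proof.
apply: divr_ge0; last by rewrite subr_ge0 ltW.
by apply: mulr_ge0 => //; exact: sqr_ge0.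
Qed.

Let BA : A * B `^ (1 - q) + 2 * B ^+ 2 = A.
Proof.
have := B1q.
by rewrite /cz_const => h; field; lra.
Qed.

Lemma Int_children P f : ok P -> intble f ->
  Int (fun z => f z * ind P z) =
  \sum_(C <- children P) Int (fun z => f z * ind C z).
Proof.
move=> okP fi; rewrite -Int_sum; last by move=> C; exact: intbleM_indic.
by congr Int; apply/funext => z; rewrite indic_children// big_distrr.
Qed.

Lemma mass_sum P : ok P -> mass P = \sum_(C <- children P) mass C.
Proof.
move=> okP; under eq_bigr do rewrite -Int_ind.
rewrite -Int_ind -Int_sum; last exact: intble_ind.
by congr Int; apply/funext => z; rewrite indic_children.
Qed.

Lemma powR_indM P x z : `|x * ind P z| `^ q = `|x| `^ q * ind P z.
Proof.
rewrite indicE; case: (_ \in _); rewrite ?mulr1// !mulr0 normr0 powR0//.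
by rewrite gt_eqF.
Qed.

Lemma intble_powRB P u c : intble u -> intble (fun z => `|u z| `^ q) ->
  intble (fun z => `|u z - c| `^ q * ind P z).
Proof.
move=> iu iuq; apply: (@le_intble _ _ _ _ _ (fun z => 2 `^ q *
    (`|u z| `^ q * ind P z + `|- c| `^ q * ind P z))).
- apply: measurable_funM_indic => //; apply: measurable_norm_powR.
  by apply: measurable_funB => //; exact: (intble_measurable iu).
- move=> z; rewrite ger0_norm ?mulr_ge0 ?powR_ge0 ?ind_ge0//.
  rewrite -mulrDl mulrA ler_wpM2r ?ind_ge0//.
  exact: normr_powRD.
- apply: intbleZ; apply: intbleD; first exact: intbleM_indic.
  exact/intbleZ/intble_ind.
Qed.

(* Descending to a child C where the average of |u| exceeds lam, the bound lam is
   replaced by B * lam, and the new part g is replaced by its average over C; the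
   correction is a multiple of a (1,oo)-atom whose weight is paid for by the part
   of the integral of |u| `^ q over C.  The geometric factor B `^ (1 - q) < 1
   gained by the larger bound makes cz_const independent of N. *)
Lemma calderon_zygmund tau N P lam u : 0 < tau -> ok P -> 0 < lam ->
  intble u -> intble (fun z => `|u z| `^ q) ->
  Int (fun z => `|u z| * ind P z) <= lam * mass P ->
  decomposes (fun z => u z * ind P z) (fun z => B * lam * ind P z)
    (cz_const * (lam `^ (1 - q) * Int (fun z => `|u z| `^ q * ind P z)))
    (tau * mass P + tau `^ (1 - q) * oscillation N P u).
Proof.
move=> t0 + + iu iuq.
elim: N P lam => [|N IH] P lam okP lam0 uP; have m0 := ok_mass_gt0 S okP.
  (* At the last generation the average is the bounded part, and the deviation from it goes to the
     remainder. *)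
  have avgE : Int (fun z => average P u * ind P z) =
      Int (fun z => u z * ind P z).
    by rewrite IntZ ?Int_ind ?mulfVK ?gt_eqF//; exact: intble_ind.
  pose v z := (u z - average P u) * ind P z.
  have vq : (fun z => `|v z| `^ q) =
      (fun z => `|u z - average P u| `^ q * ind P z).
    by apply/funext => z; rewrite /v powR_indM.
  have mv : measurable_fun setT v.
    apply: measurable_funM_indic => //; apply: measurable_funB => //.
    exact: (intble_measurable iu).
  have vI : Int v = 0.
    rewrite /v; under [X in Int X]eq_fun do rewrite mulrBl.
    rewrite IntB ?avgE ?subrr//; first exact: intbleM_indic.
    exact/intbleZ/intble_ind.
  have [||l [al vl wl]] := qatom_decomposition okP t0 mv _ _ vI.
  - by move=> z zP; rewrite /v indicE memNset// mulr0.
  - by rewrite vq; exact: intble_powRB.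
  exists (fun z => average P u * ind P z), [::], l; split => //.
  - split => //; first exact: measurable_funM.
    move=> z; rewrite normrM (ger0_norm (ind_ge0 _ _)) ler_wpM2r ?ind_ge0//.
    rewrite -(ler_pM2r m0); apply: (le_trans (normr_average okP iu)).
    by rewrite (le_trans uP)// ler_wpM2r ?(ltW m0)// ler_peMl ?ltW.
  - by move=> z; rewrite comb_nil addr0 -vl /v -mulrDl addrC subrK.
  - split; last by rewrite wl vq.
    rewrite /weight big_nil; apply: mulr_ge0; first exact: cz_const_ge0.
    apply: mulr_ge0; first exact: powR_ge0.
    by apply: Int_ge0 => z; rewrite mulr_ge0 ?powR_ge0 ?ind_ge0.
have E : (fun z => u z * ind P z) =
    (fun z => u z * \sum_(C <- children P) ind C z).
  by apply/funext => z; rewrite -indic_children.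
have E' : (fun z => B * lam * ind P z) =
    (fun z => B * lam * \sum_(C <- children P) ind C z).
  by apply/funext => z; rewrite -indic_children.
rewrite E E' Int_children// (mass_sum okP) /= !big_distrr/= -big_split/=.
apply: decomposes_sum => // C CP.
have okC := ok_children S okP CP; have mC := ok_mass_gt0 S okC.
have [small|big] := leP (Int (fun z => `|u z| * ind C z)) (lam * mass C).
  exact: IH.
have BC : lam * mass P <= B * lam * mass C.
  by rewrite (mulrC B) -mulrA ler_pM2l// (mass_children S okP).
(* A child has at least the fraction [1 / B] of the mass, so the average of [|u|] over it is at most
   [B * lam]. *)
have uC : Int (fun z => `|u z| * ind C z) <= B * lam * mass C.
  apply: le_trans BC; apply: le_trans uP.
  rewrite (Int_children okP); last exact: intble_norm.
  rewrite (big_rem C)//= lerDl sumr_ge0// => D _.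
  by apply: Int_ge0 => z; rewrite mulr_ge0 ?ind_ge0.
have Bl0 : 0 < B * lam by rewrite mulr_gt0.
have [g [l [l' [[mg gB Ig] e al al' [wl wl']]]]] := IH _ _ okC Bl0 uC.
(* [g] is only bounded by [B * (B * lam)], one factor [B] too much for the conclusion, while [c] is
   bounded by [B * lam]. *)
pose c := average C u.
have cB : `|c| <= B * lam.
  by rewrite -(ler_pM2r mC); apply: (le_trans (normr_average okC iu)).
have Ic : Int (fun z => c * ind C z) = Int (fun z => u z * ind C z).
  by rewrite IntZ ?Int_ind ?mulfVK ?gt_eqF//; exact: intble_ind.
(* The sum of the bounds on [g] and [c], rounded up with [1 < B]. *)
have M0 : 0 < 2 * B ^+ 2 * lam by rewrite !mulr_gt0// exprn_gt0.
pose v z := g z - c * ind C z.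
have vM z : `|v z| <= 2 * B ^+ 2 * lam * ind C z.
  apply: (le_trans (ler_normB _ _)).
  apply: (le_trans (lerD (gB z) (lexx _))).
  rewrite normrM (ger0_norm (ind_ge0 _ _)) -mulrDl ler_wpM2r ?ind_ge0//.
  apply: (le_trans (lerD (lexx _) cB)); rewrite expr2 -!mulrA.
  have := ler_peMl (ltW Bl0) (ltW B1); lra.
have mv : measurable_fun setT v by apply: measurable_funB => //; exact: measurable_funM.
have Iv : Int v = 0.
  rewrite IntB ?Ic ?Ig ?subrr//; last exact/intbleZ/intble_ind.
  by apply: le_intble mg gB _; exact/intbleZ/intble_ind.
have [l2 [al2 vl2 wl2]] := ooatom_decomposition okC M0 mv vM Iv.
exists (fun z => c * ind C z), (l ++ l2), l'; split => //.
- split => //; first exact: measurable_funM.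
  move=> z; rewrite normrM (ger0_norm (ind_ge0 _ _)) ler_wpM2r ?ind_ge0//.
- by move=> z; rewrite e comb_cat -vl2 /v; ring.
- exact/List.Forall_app.
split => //; rewrite weight_cat wl2 -[in leRHS]BA (mulrDl (A * _)) lerD//.
  apply: (le_trans wl); by rewrite powRM ?(ltW B0) ?(ltW lam0)// -!mulrA.
rewrite -!mulrA !ler_pM2l//.
by apply: le_mass_Int_powR => //; exact: ltW.
Qed.

End subdivision_tree.

(** * Approximation by averages over fine cells *)

Section refinement.
Context {d} {T : measurableType d} {R : realType}.
Variables (mu : {measure set T -> \bar R}) (cell : choiceType).
Variables (region : cell -> set T) (children : cell -> seq cell).
Variables (ok : cell -> Prop) (B q : R).
Local Notation mass P := (fine (mu (region P))).
Local Notation ind P := (\1_(region P) : T -> R).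
Local Notation Int := (Int mu).
Local Notation intble := (intble mu).
Local Notation average := (average mu region).
Local Notation deviation := (deviation mu region q).
Local Notation oscillation := (oscillation mu region children q).
Implicit Types (u v g b : T -> R) (P C : cell) (A : set T).

Hypotheses (S : subdivision mu region children ok B) (q1 : 1 < q).

Let q0 : 0 < q. Proof. by apply: lt_trans q1. Qed.
Let mR P : measurable (region P). Proof. exact: (region_measurable S). Qed.

Fixpoint generation N P : seq cell :=
  if N is N'.+1 then flatten [seq generation N' C | C <- children P]
  else [:: P].

Lemma generation_ok N P C : ok P -> C \in generation N P -> ok C.
Proof.
elim: N P => [|N IH] P okP /=; first by rewrite inE => /eqP ->.
move=> /flatten_mapP[D DP]; apply: IH; exact: (ok_children S okP DP).
Qed.

Lemma sum_generationS N P (F : cell -> R) :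
  \sum_(C <- generation N.+1 P) F C =
  \sum_(D <- children P) \sum_(C <- generation N D) F C.
Proof. by rewrite /= big_flatten big_map. Qed.

Lemma indic_generation N P z : ok P ->
  ind P z = \sum_(C <- generation N P) ind C z.
Proof.
elim: N P => [|N IH] P okP; first by rewrite big_seq1.
rewrite sum_generationS (indic_children S)// big_seq [RHS]big_seq.
by apply: eq_bigr => C CP; apply: IH; exact: (ok_children S okP CP).
Qed.

(** Inclusion is recovered from the identity of indicators: outside [P] a sum of nonnegative terms
    vanishes, so none of them can be 1. *)
Lemma generation_sub N P C : ok P -> C \in generation N P ->
  region C `<=` region P.
Proof.
move=> okP CP z Cz; apply: contrapT => Pz.
have := indic_generation N z okP; rewrite indicE memNset//= (big_rem C)//=.
rewrite indicE mem_set//= => /eqP; rewrite lt_eqF//.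
by rewrite ltr_wpDr ?ltr01// sumr_ge0// => D _; exact: ind_ge0.
Qed.

Lemma oscillationE N P u :
  oscillation N P u = \sum_(C <- generation N P) deviation C u.
Proof.
elim: N P => [|N IH] P; first by rewrite big_seq1.
by rewrite sum_generationS /=; apply: eq_bigr => C _.
Qed.

Lemma Int_generation N P f : ok P -> intble f ->
  \sum_(C <- generation N P) Int (fun z => f z * ind C z) =
  Int (fun z => f z * ind P z).
Proof.
move=> okP fi; rewrite -Int_sum; last by move=> C; exact: intbleM_indic.
by congr Int; apply/funext => z; rewrite (indic_generation N)// big_distrr.
Qed.

Definition Lq u := intble u /\ intble (fun z => `|u z| `^ q).

Lemma LqD u v : Lq u -> Lq v -> Lq (u \+ v).
Proof.
move=> [iu iuq] [iv ivq]; split; first exact: intbleD.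
apply: (@le_intble _ _ _ _ _ (fun z => 2 `^ q * (`|u z| `^ q + `|v z| `^ q))).
- by apply/measurable_norm_powR/measurable_funD;
    [exact: (intble_measurable iu)|exact: (intble_measurable iv)].
- by move=> z; rewrite ger0_norm ?powR_ge0//; exact: normr_powRD.
- by apply: intbleZ; exact: intbleD.
Qed.

Lemma LqZ c u : Lq u -> Lq (fun z => c * u z).
Proof.
move=> [iu iuq]; split; first exact: intbleZ.
under eq_fun do rewrite normrM powRM//; exact: intbleZ.
Qed.

Lemma Lq_le u v : measurable_fun setT u -> (forall z, `|u z| <= `|v z|) ->
  Lq v -> Lq u.
Proof.
move=> mu_ uv [iv ivq]; split; first exact: le_intble mu_ uv (intble_norm iv).
apply: (le_intble _ _ ivq); first exact: measurable_norm_powR.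
move=> z; rewrite ger0_norm ?powR_ge0//.
by apply: ge0_ler_powR; rewrite ?nnegrE// ltW.
Qed.

Lemma Lq_indic A P : measurable A -> Lq (fun z => \1_A z * ind P z).
Proof.
move=> mA.
have i1 : intble (fun z => \1_A z * ind P z).
  under eq_fun do rewrite mulrC; apply: intbleM_indic => //.
  exact: (intble_ind S).
split => //.
rewrite (_ : (fun z => _) = (fun z => \1_A z * ind P z))//.
apply/funext => z; rewrite !indicE; do 2 case: (_ \in _) => /=;
  by rewrite ?mulr0 ?mul0r ?mulr1 ?normr0 ?normr1 ?powR1 ?powR0 ?gt_eqF.
Qed.

Lemma average_eq C u v : (forall z, region C z -> u z = v z) ->
  average C u = average C v.
Proof.
move=> uv; congr (_ / _); congr Int; apply/funext => z; rewrite indicE.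
by have [zC|zC] := pselect (region C z); [rewrite uv|rewrite memNset// !mulr0].
Qed.

Lemma deviation_eq C u v : (forall z, region C z -> u z = v z) ->
  deviation C u = deviation C v.
Proof.
move=> uv; congr Int; apply/funext => z; rewrite indicE (average_eq uv).
by have [zC|zC] := pselect (region C z); [rewrite uv|rewrite memNset// !mulr0].
Qed.

Lemma averageD C u v : intble u -> intble v ->
  average C (u \+ v) = average C u + average C v.
Proof.
move=> iu iv; rewrite -mulrDl -IntD; [|exact: intbleM_indic..].
by congr (Int _ / _); apply/funext => z /=; rewrite mulrDl.
Qed.

Lemma averageZ C c u : intble u ->
  average C (fun z => c * u z) = c * average C u.
Proof.
move=> iu; rewrite mulrA -IntZ; last exact: intbleM_indic.
by congr (Int _ / _); apply/funext => z /=; rewrite mulrA.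
Qed.

Let dev_intble C c u : Lq u -> intble (fun z => `|u z - c| `^ q * ind C z).
Proof. by move=> [iu iuq]; exact: (intble_powRB S). Qed.

Lemma deviationD C u v : Lq u -> Lq v ->
  deviation C (u \+ v) <= 2 `^ q * (deviation C u + deviation C v).
Proof.
move=> Lu Lv; have [iu _] := Lu; have [iv _] := Lv.
rewrite -IntD; [|exact: dev_intble..].
rewrite -IntZ; last by apply: intbleD; exact: dev_intble.
apply: le_Int.
- by apply: dev_intble; exact: LqD.
- by apply/intbleZ/intbleD; exact: dev_intble.
move=> z /=; rewrite averageD//.
move: (average C u) (average C v) => a b.
rewrite -mulrDl mulrA ler_wpM2r ?ind_ge0//.
by rewrite opprD addrACA normr_powRD.
Qed.

Lemma deviationZ C c u : Lq u ->
  deviation C (fun z => c * u z) = `|c| `^ q * deviation C u.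
Proof.
move=> Lu; have [iu _] := Lu; rewrite -IntZ; last exact: dev_intble.
congr Int; apply/funext => z; rewrite averageZ//.
move: (average C u) => a; rewrite -mulrBr normrM powRM//.
by rewrite mulrA.
Qed.

Let K : R := 2 `^ q * 2.

(** Jensen's inequality for the average, which is [le_mass_Int_powR] at the height [|a|], combined
    with [normr_powRD]. The height must be positive, hence the separate case [a = 0]. *)
Lemma deviation_le C u : ok C -> Lq u ->
  deviation C u <= K * Int (fun z => `|u z| `^ q * ind C z).
Proof.
move=> okC Lu; have [iu iuq] := Lu; have m0 := ok_mass_gt0 S okC.
have iuC : intble (fun z => `|u z| `^ q * ind C z) by exact: intbleM_indic.
have iI := intble_ind S C.
set a := average C u.
have aq : `|a| `^ q * mass C <= Int (fun z => `|u z| `^ q * ind C z).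
  have [->|a0] := eqVneq a 0.
    rewrite normr0 powR0 ?gt_eqF// mul0r; apply: Int_ge0 => z.
    by rewrite mulr_ge0 ?powR_ge0 ?ind_ge0.
  have na0 : 0 < `|a| by rewrite normr_gt0.
  have := le_mass_Int_powR S q1 okC na0 iu iuq (normr_average S okC iu).
  rewrite -opprB powRN ler_pdivlMl ?powR_gt0// mulrA.
  by rewrite (mulrC (_ `^ _)) mulr_powRB1.
apply: (@le_trans _ _ (Int (fun z => 2 `^ q *
    (`|u z| `^ q * ind C z + `|- a| `^ q * ind C z)))).
  apply: le_Int.
  - exact: dev_intble.
  - by apply/intbleZ/intbleD => //; exact: intbleZ.
  - move=> z; rewrite -mulrDl mulrA ler_wpM2r ?ind_ge0//.
    exact: normr_powRD.
rewrite IntZ; last by apply: intbleD => //; exact: intbleZ.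
rewrite IntD//; last exact: intbleZ.
rewrite IntZ// (Int_ind S) normrN /K -mulrA ler_wpM2l ?powR_ge0//.
by rewrite mulrDl mul1r lerD2l.
Qed.

(** Averages over the [N]-th generation converge to [u] in L^q on [P]. All large [N] are required so
    that two thresholds combine by a maximum. *)
Definition resolvable P u := forall eps, 0 < eps ->
  exists N0, forall N, (N0 <= N)%N -> oscillation N P u <= eps.

Lemma resolvable_eq P u v : ok P -> (forall z, region P z -> u z = v z) ->
  resolvable P u -> resolvable P v.
Proof.
move=> okP uv ru eps /ru[N0 h]; exists N0 => N /h; apply: le_trans.
suff -> : oscillation N P v = oscillation N P u by [].
rewrite [LHS]oscillationE [RHS]oscillationE; apply: eq_big_seq => C CP.
by apply: deviation_eq => z /(generation_sub okP CP) Pz; rewrite uv.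
Qed.

Lemma oscillationD N P u v : Lq u -> Lq v ->
  oscillation N P (u \+ v) <= 2 `^ q * (oscillation N P u + oscillation N P v).
Proof.
move=> Lu Lv; rewrite !oscillationE.
rewrite -big_split/= big_distrr/=.
by apply: ler_sum => C _; exact: deviationD.
Qed.

Lemma oscillation_le N P u : ok P -> Lq u ->
  oscillation N P u <= K * Int (fun z => `|u z| `^ q * ind P z).
Proof.
move=> okP Lu; have [iu iuq] := Lu.
rewrite oscillationE -(Int_generation N okP iuq) big_distrr/=.
rewrite [leLHS]big_seq [leRHS]big_seq.
by apply: ler_sum => C CP; apply: deviation_le => //; exact: (generation_ok okP CP).
Qed.

Lemma resolvable0 P : resolvable P (fun=> 0).
Proof.
move=> eps e0; exists 0%N => N _; rewrite oscillationE big1 ?ltW// => C _.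
rewrite /deviation (_ : average C _ = 0); last first.
  by rewrite /average; under eq_fun do rewrite mul0r; rewrite Int0 mul0r.
under eq_fun do rewrite subr0 normr0 powR0 ?gt_eqF// mul0r.
by rewrite Int0.
Qed.

Lemma resolvableD P u v : Lq u -> Lq v -> resolvable P u -> resolvable P v ->
  resolvable P (u \+ v).
Proof.
move=> Lu Lv ru rv eps e0; have p0 := powR_gt0 q (ltr0Sn R 1).
have e1 : 0 < eps / (2 `^ q) / 2 by rewrite !divr_gt0.
have [N1 h1] := ru _ e1; have [N2 h2] := rv _ e1; exists (maxn N1 N2) => N.
rewrite geq_max => /andP[/h1 a1 /h2 a2].
apply: (le_trans (oscillationD _ _ Lu Lv)); rewrite mulrC -ler_pdivlMr//.
by rewrite (splitr (eps / _)) lerD.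
Qed.

Lemma resolvableZ P c u : Lq u -> resolvable P u ->
  resolvable P (fun z => c * u z).
Proof.
move=> Lu ru eps e0.
have c1 : 0 < `|c| `^ q + 1 by rewrite ltr_wpDl// powR_ge0.
have [N0 h] := ru _ (divr_gt0 e0 c1); exists N0 => N /h {}h.
rewrite oscillationE; under eq_bigr do rewrite deviationZ//.
rewrite -big_distrr/= -oscillationE.
apply: (le_trans (ler_wpM2l (powR_ge0 _ _) h)).
by rewrite mulrA ler_pdivrMr// mulrC ler_pM2l// lerDl.
Qed.

(** [oscillation_le] controls the oscillation of [u - v] uniformly in [N], so [v] can be fixed
    before [N]. *)
Lemma resolvable_limit P u : ok P -> Lq u ->
  (forall eps, 0 < eps -> exists v, [/\ Lq v, resolvable P v &
     Int (fun z => `|u z - v z| `^ q) <= eps]) -> resolvable P u.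
Proof.
move=> okP Lu h eps e0; have p0 := powR_gt0 q (ltr0Sn R 1).
have K0 : 0 < K by rewrite mulr_gt0.
have e1 : 0 < eps / (2 `^ q) / 2 by rewrite !divr_gt0.
have [v [Lv rv uv]] := h _ (divr_gt0 e1 K0).
have [N0 h0] := rv _ e1; exists N0 => N /h0 {}h0.
have Lw : Lq (u \+ (fun z => -1 * v z)) by apply: LqD => //; exact: LqZ.
have -> : u = v \+ (u \+ (fun z => -1 * v z)).
  by apply/funext => z /=; ring.
apply: (le_trans (oscillationD _ _ Lv Lw)); rewrite mulrC -ler_pdivlMr//.
rewrite (splitr (eps / _)) lerD// (le_trans (oscillation_le N okP Lw))//.
rewrite mulrC -ler_pdivlMr//; apply: le_trans uv.
have [iw iwq] := Lw.
have E : (fun z => `|u z - v z| `^ q) =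
    (fun z => `|(u \+ (fun z => -1 * v z)) z| `^ q).
  by apply/funext => z /=; rewrite mulN1r.
rewrite E; apply: le_Int => // [|z]; first exact: intbleM_indic.
by rewrite ler_piMr ?powR_ge0// indicE; case: (_ \in _); rewrite ?ler01.
Qed.

End refinement.

(** * The sigma-algebra of sets resolved by fine cells *)

Section settled_sets.
Context {d} {T : measurableType d} {R : realType}.
Variables (mu : {measure set T -> \bar R}) (cell : choiceType).
Variables (region : cell -> set T) (children : cell -> seq cell).
Variables (ok : cell -> Prop) (B : R).
Local Notation ind P := (\1_(region P) : T -> R).
Local Notation Int := (Int mu).
Local Notation intble := (intble mu).
Local Notation generation := (generation children).
Implicit Types (u v g b : T -> R) (P C : cell) (A : set T).

Hypothesis S : subdivision mu region children ok B.

Let mR P : measurable (region P). Proof. exact: (region_measurable S). Qed.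

(** The mass of the intersection of [A] and [C], written so that linearity of the integral
    applies. *)
Definition part A C : R := Int (fun z => \1_A z * ind C z).

(* Vanishing defects mean that almost all the mass of P lies in cells that are
   almost contained in A or almost disjoint from A. *)
Definition defect N P A : R :=
  \sum_(C <- generation N P) Num.min (part A C) (part (~` A) C).

Definition settled P A := measurable A /\ forall eps, 0 < eps ->
  exists N0, forall N, (N0 <= N)%N -> defect N P A <= eps.

Let part_intble A C : measurable A -> intble (fun z => \1_A z * ind C z).
Proof.
by move=> mA; under eq_fun do rewrite mulrC; apply: intbleM_indic => //;
  exact: (intble_ind S).
Qed.

Lemma part_ge0 A C : 0 <= part A C.
Proof. by apply: Int_ge0 => z; rewrite mulr_ge0 ?ind_ge0// indicE. Qed.

Lemma le_part A A' C : measurable A -> measurable A' -> A `<=` A' ->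
  part A C <= part A' C.
Proof.
move=> mA mA' AA'; apply: le_Int => [||z]; [exact: part_intble..|].
by rewrite ler_wpM2r ?ind_ge0// !indicE ler_nat;
  case: (boolP (z \in A)) => //= /set_mem/AA'/mem_set ->.
Qed.

Lemma le_partU A A' C : measurable A -> measurable A' ->
  part (A `|` A') C <= part A C + part A' C.
Proof.
move=> mA mA'; rewrite -IntD; [|exact: part_intble..].
apply: le_Int => [||z /=].
- by apply: part_intble; exact: measurableU.
- by apply: intbleD; exact: part_intble.
rewrite -mulrDl ler_wpM2r ?ind_ge0// !indicE in_setU -natrD ler_nat.
by case: (_ \in _); case: (_ \in _).
Qed.

Lemma settled_eq P A A' : ok P -> measurable A' ->
  A `&` region P = A' `&` region P -> settled P A -> settled P A'.
Proof.
move=> okP mA' AA' [mA hA]; split => // eps /hA[N0 h]; exists N0 => N /h.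
suff -> : defect N P A' = defect N P A by [].
apply: eq_big_seq => C CP.
have H z : region C z -> (z \in A) = (z \in A').
  move=> /(generation_sub S okP CP) Pz.
  have /seteqP[AA AA2] := AA'.
  apply/idP/idP; rewrite !inE => Az.
    by have [] := AA z (conj Az Pz).
  by have [] := AA2 z (conj Az Pz).
have E1 : part A' C = part A C.
  congr Int; apply/funext => z; rewrite !indicE.
  have [Cz|Cz] := pselect (region C z); first by rewrite H.
  by rewrite [z \in region C]memNset// !mulr0.
have E2 : part (~` A') C = part (~` A) C.
  congr Int; apply/funext => z; rewrite !indicE.
  have [Cz|Cz] := pselect (region C z); first by rewrite !in_setC H.
  by rewrite [z \in region C]memNset// !mulr0.
by rewrite E1 E2.
Qed.

Lemma settledC P A : settled P A -> settled P (~` A).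
Proof.
move=> [mA hA]; split; first exact: measurableC.
move=> eps /hA[N0 h]; exists N0 => N /h.
suff -> : defect N P (~` A) = defect N P A by [].
by apply: eq_bigr => C _; rewrite setCK minC.
Qed.

(** The inequality holds cell by cell: if one of the sets nearly fills [C], so does the union; if
    both nearly avoid [C], the share of the union is at most the sum of theirs. *)
Lemma settledU P A A' : settled P A -> settled P A' -> settled P (A `|` A').
Proof.
move=> [mA hA] [mA' hA']; split; first exact: measurableU.
move=> eps e0; have e2 : 0 < eps / 2 by rewrite divr_gt0.
have [N1 h1] := hA _ e2; have [N2 h2] := hA' _ e2; exists (maxn N1 N2) => N.
rewrite geq_max => /andP[/h1 a1 /h2 a2]; rewrite (splitr eps).
apply: le_trans (lerD a1 a2); rewrite -big_split/=; apply: ler_sum => C _.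
have H1 := le_partU C mA mA'.
have mAA : measurable (A `|` A') by exact: measurableU.
have H2 : part (~` (A `|` A')) C <= part (~` A) C.
  by apply: le_part; [exact: measurableC..|apply: subsetC; exact: subsetUl].
have H3 : part (~` (A `|` A')) C <= part (~` A') C.
  by apply: le_part; [exact: measurableC..|apply: subsetC; exact: subsetUr].
have := part_ge0 A C; have := part_ge0 A' C.
have := part_ge0 (~` A) C; have := part_ge0 (~` A') C.
by rewrite !minEle; do 3 case: ifPn; rewrite -?ltNge; lra.
Qed.

Lemma settled0 P : settled P set0.
Proof.
split => // eps e0; exists 0%N => N _; rewrite /defect big1 ?ltW// => C _.
rewrite (_ : part set0 C = 0); first by rewrite min_l// part_ge0.
by rewrite /part; under eq_fun do rewrite indic0 mul0r; rewrite Int0.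
Qed.

(** What the union adds to a long finite union has small mass in [P] by dominated convergence, and
    it raises the defect by at most that mass. *)
Lemma settled_bigcup P (F : nat -> set T) : ok P ->
  (forall n, settled P (F n)) -> settled P (\bigcup_n F n).
Proof.
move=> okP sF.
pose G n := \big[setU/set0]_(i < n.+1) F i.
have sG n : settled P (G n).
  rewrite /G; elim: n.+1 => [|k IH]; first by rewrite big_ord0; exact: settled0.
  by rewrite big_ord_recr/=; exact: settledU.
rewrite -bigcup_bigsetU_bigcup -/(G _).
have mG n : measurable (G n) by have [] := sG n.
have mGG : measurable (\bigcup_n G n) by exact: bigcup_measurable.
split => // eps e0; have e2 : 0 < eps / 2 by rewrite divr_gt0.
pose D n := (\bigcup_n G n) `\` G n.
have mD n : measurable (D n) by exact: measurableD.
have [n hn] : exists n, part (D n) P <= eps / 2.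
  apply: (@dominated_Int_small _ _ _ mu _ (ind P)) => //.
  - by move=> n; apply: measurable_funM.
  - move=> n z; apply/andP; split; first by rewrite mulr_ge0// indicE.
    by rewrite ler_piMl ?ind_ge0// indicE lern1 leq_b1.
  - move=> z; apply: cvg_near_cst.
    have [[m _ Gm]|Gz] := pselect ((\bigcup_n G n) z); last first.
      by near=> n; rewrite indicE memNset ?mul0r// => -[].
    near=> n; rewrite indicE memNset ?mul0r// => -[_]; apply.
    have mn : (m <= n)%N by near: n; exists m.
    move: Gm; rewrite /G -!bigcup_mkord => -[i /= im Fi].
    by exists i => //=; exact: (leq_trans im).
  - exact: (intble_ind S).
have [_ /(_ _ e2)[N0 h]] := sG n; exists N0 => N /h a1.
rewrite (splitr eps); apply: le_trans (lerD a1 hn).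
have <- : \sum_(C <- generation N P) part (D n) C = part (D n) P.
  have i1 : intble (fun z => \1_(D n) z * ind P z) by exact: part_intble.
  rewrite -[RHS]/(Int _).
  (* [D n] may have infinite measure; the spare factor [ind P] gives [Int_generation] an integrable
     function. *)
  have -> : (fun z => \1_(D n) z * ind P z) =
      (fun z => \1_(D n) z * ind P z * ind P z).
    apply/funext => z; rewrite -mulrA; congr (_ * _).
    by rewrite indicE; case: (_ \in _); rewrite ?mulr1 ?mulr0.
  rewrite -(Int_generation S N okP i1); apply: eq_big_seq => C CP.
  congr Int; apply/funext => z; rewrite -mulrA; congr (_ * _).
  have [Cz|Cz] := pselect (region C z); last by rewrite indicE memNset// mulr0.
  by rewrite [X in _ = X * _]indicE mem_set ?mul1r//; exact: (generation_sub S okP CP).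
rewrite -big_split/=; apply: ler_sum => C _.
have GD : \bigcup_n G n = G n `|` D n.
  by rewrite /D setDUK//; exact: bigcup_sup.
have H1 := le_partU C (mG n) (mD n).
have H2 : part (~` (\bigcup_n G n)) C <= part (~` G n) C.
  by apply: le_part; [exact: measurableC..|apply: subsetC; exact: bigcup_sup].
rewrite -GD in H1; have := part_ge0 (D n) C.
by rewrite !minEle; do 2 case: ifPn; rewrite -?ltNge; lra.
Unshelve. all: by end_near.
Qed.

Lemma settled_algebra P : ok P -> sigma_algebra setT (settled P).
Proof.
move=> okP; split; first exact: settled0.
  by move=> A; rewrite setTD; exact: settledC.
by move=> F; exact: settled_bigcup.
Qed.

(** The criterion for generators: once no cell straddles the boundary of [A], the defect is zero. *)
Lemma settled_split P A N0 : measurable A ->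
  (forall N C, (N0 <= N)%N -> C \in generation N P ->
     region C `<=` A \/ region C `<=` ~` A) -> settled P A.
Proof.
move=> mA h; split => // eps e0; exists N0 => N N0N.
rewrite /defect big_seq big1 ?ltW// => C CP.
have H A' : region C `<=` ~` A' -> part A' C = 0.
  move=> CA; rewrite /part -(Int0 mu); congr Int; apply/funext => z.
  have [Cz|Cz] := pselect (region C z); last first.
    by rewrite [X in _ * X]indicE memNset// mulr0.
  by rewrite indicE memNset ?mul0r//; exact: CA.
have [CA|CA] := h _ _ N0N CP.
  have -> : part (~` A) C = 0 by apply: H; rewrite setCK.
  by rewrite min_r// part_ge0.
by rewrite (H _ CA) min_l// part_ge0.
Qed.

End settled_sets.

(** * Approximation in L^q and decomposition of one real atom *)

Section resolvable_functions.
Context {d} {T : measurableType d} {R : realType}.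
Variables (mu : {measure set T -> \bar R}) (cell : choiceType).
Variables (region : cell -> set T) (children : cell -> seq cell).
Variables (ok : cell -> Prop) (B q : R).
Local Notation mass P := (fine (mu (region P))).
Local Notation ind P := (\1_(region P) : T -> R).
Local Notation Int := (Int mu).
Local Notation intble := (intble mu).
Local Notation average := (average mu region).
Local Notation deviation := (deviation mu region q).
Local Notation oscillation := (oscillation mu region children q).
Local Notation generation := (generation children).
Local Notation resolvable := (resolvable mu region children q).
Local Notation settled := (settled mu region children).
Local Notation part := (part mu region).
Local Notation real_ooatom := (real_ooatom mu region ok).
Local Notation real_qatom := (real_qatom mu region ok q).
Local Notation Lq := (Lq mu q).
Implicit Types (u v g b : T -> R) (P C : cell) (A : set T).

Hypotheses (S : subdivision mu region children ok B) (q1 : 1 < q).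

Let q0 : 0 < q. Proof. by apply: lt_trans q1. Qed.
Let mR P : measurable (region P). Proof. exact: (region_measurable S). Qed.

Let deviation_indic_le P C A : ok C -> region C `<=` region P -> measurable A ->
  deviation C (fun z => \1_A z * ind P z) <= 2 `^ q * 2 * part A C.
Proof.
move=> okC CP mA; have LA := Lq_indic S q1 P mA.
apply: (le_trans (deviation_le S q1 okC LA)).
rewrite ler_pM2l ?mulr_gt0 ?powR_gt0//; apply: le_Int => [||z].
- by apply: intbleM_indic => //; have [] := LA.
- by have [] := Lq_indic S q1 C mA.
rewrite ler_wpM2r ?ind_ge0// !indicE; do 2 case: (_ \in _) => /=;
  by rewrite ?mulr0 ?mul0r ?mulr1 ?normr0 ?normr1 ?powR1 ?powR0 ?gt_eqF.
Qed.

(** On a cell the indicators of [A] and of its complement add up to 1, so they have the same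
    deviation. It is therefore controlled by the smaller of the two masses, which explains the
    minimum in [defect]. *)
Lemma resolvable_indic P A : ok P -> settled P A ->
  resolvable P (fun z => \1_A z * ind P z).
Proof.
move=> okP [mA hA] eps e0.
have K0 : 0 < (2 : R) `^ q * 2 by rewrite mulr_gt0 ?powR_gt0.
have [N0 h] := hA _ (divr_gt0 e0 K0); exists N0 => N /h.
rewrite ler_pdivlMr// mulrC => {}h; apply: le_trans h.
rewrite oscillationE big_distrr/= [leLHS]big_seq [leRHS]big_seq.
apply: ler_sum => C CP.
have okC := generation_ok S okP CP; have m0 := ok_mass_gt0 S okC.
have CPs := generation_sub S okP CP.
rewrite minEle; case: ifP => _; first exact: deviation_indic_le.
apply: le_trans (deviation_indic_le okC CPs (measurableC mA)).
have LP A' : measurable A' -> Lq (fun z => \1_A' z * ind P z).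
  exact: (Lq_indic S q1 P).
have LC : Lq (ind P).
  by have := LP _ measurableT; under eq_fun do rewrite indicT mul1r.
have E z : \1_(~` A) z * ind P z =
    (ind P \+ (fun z => -1 * (\1_A z * ind P z))) z.
  by rewrite /= !indicE in_setC; case: (_ \in A) => /=; ring.
have [iP _] := LC; have [iA _] := LP _ mA.
have avE : average C (fun z => \1_(~` A) z * ind P z) =
    1 - average C (fun z => \1_A z * ind P z).
  rewrite (average_eq _ (v := ind P \+ (fun z => -1 * (\1_A z * ind P z)))) => [|z _//].
  rewrite (averageD S)//; last exact: intbleZ.
  rewrite (averageZ S)// mulN1r; congr (_ - _).
  have -> : average C (ind P) = average C (ind C).
    by apply: average_eq => z Cz; rewrite !indicE !mem_set//; exact: CPs.
  exact: (average_ind S).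
suff -> : deviation C (fun z => \1_A z * ind P z) =
          deviation C (fun z => \1_(~` A) z * ind P z) by [].
congr Int; apply/funext => z; rewrite avE.
have [Cz|Cz] := pselect (region C z); last first.
  by rewrite [ind C z]indicE memNset// !mulr0.
congr (_ `^ _ * _); rewrite E /= [ind P z]indicE mem_set; last exact: CPs.
rewrite -[LHS]normrN; congr `|_|.
by rewrite (_ : true%:R = 1)//; ring.
Qed.

Lemma resolvable_sum P I (s : seq I) (F : I -> T -> R) :
  (forall i, Lq (F i)) -> (forall i, resolvable P (F i)) ->
  Lq (fun z => \sum_(i <- s) F i z) /\
  resolvable P (fun z => \sum_(i <- s) F i z).
Proof.
move=> LF rF; elim: s => [|i s [IH1 IH2]].
  under eq_fun do rewrite big_nil.
  split; last exact: resolvable0.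
  split; first exact: intble0.
  by under eq_fun do rewrite normr0 powR0 ?gt_eqF//; exact: intble0.
under eq_fun do rewrite big_cons.
by split; [apply: LqD|apply: (resolvableD S)].
Qed.

(** Simple functions increasing to [u] converge in L^q, the q-th powers of the errors being
    dominated by that of [u]. *)
Lemma resolvable_nonneg P u : ok P ->
  (forall A, measurable A -> settled P A) -> Lq u -> (forall z, 0 <= u z) ->
  resolvable P u.
Proof.
move=> okP hA Lu u0; have [iu iuq] := Lu.
have mu_ := intble_measurable iu.
pose sf := nnsfun_approx measurableT ((measurable_EFinP _ _).2 mu_).
pose s n : T -> R := sf n.
have s_cvg z : s n z @[n --> \oo] --> u z.
  have : (s n z)%:E @[n --> \oo] --> (u z)%:E.
    by apply: cvg_nnsfun_approx => // x _; rewrite lee_fin.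
  by move=> /fine_cvgP[_].
have s_le n z : s n z <= u z.
  rewrite -(cvg_lim _ (s_cvg z))//; apply: nondecreasing_cvgn_le.
    by move=> a b ab; have /lefP := nd_nnsfun_approx measurableT ((measurable_EFinP _ _).2 mu_) ab; exact.
  by apply/cvg_ex; exists (u z).
(* Level sets may have infinite measure, so everything is cut to [P]; values outside [P] do not
   affect the oscillation. *)
pose v n z := s n z * ind P z.
have vE n : v n = fun z => \sum_(y <- finmap.enum_fset (fset_set (range (sf n))))
    y * (\1_(sf n @^-1` [set y]) z * ind P z).
  apply/funext => z; rewrite /v /s (fimfunE (sf n)) fsbig_finite//= mulr_suml.
  by apply: eq_bigr => y _; rewrite mulrA.
have Lv n : Lq (v n) /\ resolvable P (v n).
  rewrite vE; apply: resolvable_sum => y.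
    by apply/LqZ/(Lq_indic S q1).
  apply: (resolvableZ S) => //; first exact: (Lq_indic S q1).
  by apply: resolvable_indic => //; exact: hA.
pose w z := u z * ind P z.
have Lw : Lq w.
  apply: (Lq_le q1 _ _ Lu); first exact: measurable_funM.
  move=> z; rewrite normrM ler_piMr// indicE; case: (_ \in _);
    by rewrite ?normr1 ?normr0.
suff : resolvable P w.
  apply: (resolvable_eq S okP) => z Pz.
  by rewrite /w indicE mem_set// mulr1.
apply: (resolvable_limit S q1) => // eps e0.
have [|||n hn] := dominated_Int_small (f := fun n z => `|w z - v n z| `^ q)
  _ _ _ iuq e0.
- move=> n; apply: measurable_norm_powR; apply: measurable_funB.
    exact: measurable_funM.
  by apply: measurable_funM.
- move=> n z; rewrite powR_ge0/=; apply: ge0_ler_powR; rewrite ?nnegrE ?(ltW q0)//.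
  have s0 : 0 <= s n z by [].
  rewrite /w /v -mulrBl normrM !ger0_norm ?ind_ge0// ?subr_ge0//.
  apply: (@le_trans _ _ (u z - s n z)); last by rewrite gerBl.
  by rewrite ler_piMr ?subr_ge0// indicE; case: (_ \in _); rewrite ?ler01.
- move=> z.
  apply: cvg_normr_powR0 => //; rewrite -[X in _ --> X](subrr (w z)).
  apply: cvgB; first exact: cvg_cst.
  by apply: cvgM; [exact: s_cvg|exact: cvg_cst].
by exists (v n); have [] := Lv n.
Qed.

Lemma resolvable_Lq P u : ok P -> (forall A, measurable A -> settled P A) ->
  Lq u -> resolvable P u.
Proof.
move=> okP hA Lu; have [iu _] := Lu; have mu_ := intble_measurable iu.
have pos v : Lq v -> Lq (fun z => Num.max (v z) 0).
  move=> Lv; have [iv _] := Lv; apply: (Lq_le q1 _ _ Lv).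
    by apply: measurable_maxr => //; exact: (intble_measurable iv).
  move=> z; have [v0|v0] := leP (v z) 0; first by rewrite normr0.
  by [].
have -> : u = (fun z => Num.max (u z) 0) \+
    (fun z => -1 * Num.max (-1 * u z) 0).
  apply/funext => z /=; rewrite !mulN1r oppr_max opprK oppr0.
  by have [u0|u0] := leP (u z) 0; rewrite ?add0r ?addr0.
have L1 := pos _ Lu; have L2 := pos _ (LqZ (-1) Lu).
have r v : Lq (fun z => Num.max (v z) 0) ->
    resolvable P (fun z => Num.max (v z) 0).
  by move=> Lv; apply: resolvable_nonneg => // z; rewrite le_max lexx orbT.
apply: (resolvableD S) => //.
- exact: LqZ.
- exact: r.
- by apply: (resolvableZ S) => //; exact: r.
Qed.

Section one_atom.
Variables (P : cell) (u : T -> R).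
Hypotheses (okP : ok P) (mu_ : measurable_fun setT u).
Hypotheses (u0 : forall z, ~ region P z -> u z = 0).
Hypothesis iuq : intble (fun z => `|u z| `^ q).
Hypothesis uq : Int (fun z => `|u z| `^ q) <= mass P `^ (1 - q).

Let m0 : 0 < mass P. Proof. exact: (ok_mass_gt0 S okP). Qed.

Let iu : intble u.
Proof.
apply: (le_intble mu_ _ (intbleD (intble_ind S P) iuq)) => z /=.
have [Pz|Pz] := pselect (region P z).
  by rewrite indicE mem_set// le_D1_powR// ltW.
by rewrite u0// normr0 addr_ge0// powR_ge0.
Qed.

Let lmq : (mass P)^-1 `^ (1 - q) * mass P `^ (1 - q) = 1.
Proof. by rewrite -powRM ?mulVf ?powR1 ?gt_eqF ?invr_ge0 ?(ltW m0). Qed.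

Let uqP : (fun z => `|u z| `^ q * ind P z) = (fun z => `|u z| `^ q).
Proof.
apply/funext => z; have [Pz|Pz] := pselect (region P z).
  by rewrite indicE mem_set// mulr1.
by rewrite u0// normr0 powR0 ?mul0r// gt_eqF.
Qed.

Let lX : (mass P)^-1 `^ (1 - q) * Int (fun z => `|u z| `^ q * ind P z) <= 1.
Proof. by rewrite uqP (le_trans (ler_wpM2l (powR_ge0 _ _) uq))// lmq. Qed.

(** At the height [(mass P)^-1] the bound of [Int_normr_le] becomes [(1 - q^-1) + q^-1]. *)
Lemma qatom_norm_le1 : Int (fun z => `|u z|) <= 1.
Proof.
have lam0 : 0 < (mass P)^-1 by rewrite invr_gt0.
have -> : (fun z => `|u z|) = (fun z => `|u z| * ind P z).
  apply/funext => z; have [Pz|Pz] := pselect (region P z).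
    by rewrite indicE mem_set// mulr1.
  by rewrite u0// normr0 mul0r.
apply: (le_trans (Int_normr_le S q1 okP lam0 iu iuq)).
rewrite mulVf ?gt_eqF//.
have := lX; rewrite -(ler_pM2l (_ : 0 < q^-1)) ?invr_gt0//; lra.
Qed.

Theorem real_atom_decomposition eps : 1 < B ->
  (forall A, measurable A -> settled P A) -> Int u = 0 -> 0 < eps ->
  exists l l', [/\ forall z, u z = comb l z + comb l' z,
    List.Forall (fun p => real_ooatom p.2) l,
    List.Forall (fun p => real_qatom p.2) l' &
    weight l <= cz_const B q + B /\ weight l' <= eps].
Proof.
move=> B1 hA Iu e0.
have B0 : 0 < B by apply: lt_trans B1.
have uP z : u z * ind P z = u z.
  have [Pz|Pz] := pselect (region P z); first by rewrite indicE mem_set// mulr1.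
  by rewrite u0// mul0r.
pose lam := (mass P)^-1; have lam0 : 0 < lam by rewrite invr_gt0.
have lm : lam * mass P = 1 by rewrite mulVf ?gt_eqF.
have small : Int (fun z => `|u z| * ind P z) <= lam * mass P.
  rewrite lm; apply: le_trans qatom_norm_le1; apply: le_Int.
  - by apply: intbleM_indic => //; exact: intble_norm.
  - exact: intble_norm.
  - by move=> z; rewrite ler_piMr// indicE lern1 leq_b1.
(* [tau * mass P] is half of [eps]; with [tau] fixed, [N] is then chosen to bring the oscillation
   term below the other half. *)
pose tau := eps / 2 / mass P.
have t0 : 0 < tau by rewrite !divr_gt0.
have [] := resolvable_Lq okP hA (conj iu iuq) (eps := eps / 2 / tau `^ (1 - q)).
  by rewrite !divr_gt0 ?powR_gt0.
move=> N /(_ N (leqnn N)) hN.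
have [g [l [l' [[mg gB Ig] e al al' [wl wl']]]]] :=
  calderon_zygmund S B1 q1 N t0 okP lam0 iu iuq small.
have M0 : 0 < B * lam by rewrite mulr_gt0.
(* As [u] has mean zero, so has [g], which is then a multiple of a (1,oo)-atom with weight
   [B * lam * mass P = B]. *)
have Ig0 : Int g = 0 by rewrite Ig -[RHS]Iu; congr Int; apply/funext.
have [l2 [al2 gl2 wl2]] := ooatom_decomposition S okP M0 mg gB Ig0.
exists (l ++ l2), l'; split => //.
- by move=> z; rewrite -uP e comb_cat gl2; ring.
- exact/List.Forall_app.
split.
  rewrite weight_cat wl2 -mulrA lm mulr1 lerD2r (le_trans wl)//.
  by rewrite ler_piMr// cz_const_ge0.
apply: (le_trans wl'); rewrite (splitr eps) lerD//.
  by rewrite /tau mulfVK// gt_eqF.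
by rewrite mulrC -ler_pdivlMr ?powR_gt0.
Qed.

End one_atom.

End resolvable_functions.

(** * The tree of admissible cells *)

Section haar_measure_of_boxes.
Context {R : realType}.
Local Notation leb := (@lebesgue_measure R).

Lemma integral_inv_cc (a b : R) : 0 < a -> a < b ->
  (\int[leb]_(y in `[a, b]) (y^-1)%:E = (ln b - ln a)%:E)%E.
Proof.
move=> a0 ab; have b0 : 0 < b by apply: lt_trans ab.
rewrite (@continuous_FTC2 _ _ (@ln R))//.
- apply: continuous_in_subspaceT => x; rewrite inE/= in_itv/= => /andP[ax _].
  apply: continuousV; last exact: cvg_id.
  by rewrite gt_eqF// (lt_le_trans a0).
- split.
  + move=> x; rewrite in_itv/= => /andP[ax _]; apply: ex_derive.
    by apply: is_derive1_ln; exact: lt_trans ax.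
  + by apply: cvg_at_right_filter; exact: continuous_ln.
  + by apply: cvg_at_left_filter; exact: continuous_ln.
- move=> x; rewrite in_itv/= => /andP[ax _].
  have x0 : 0 < x by apply: lt_trans ax.
  by rewrite derive1E; have [_ ->] := is_derive1_ln x0.
Qed.

Let measurable_inv (D : set R) : measurable D -> D `<=` `]0, +oo[ ->
  measurable_fun D (fun y : R => (y^-1)%:E).
Proof.
move=> mD D0; apply/measurable_EFinP.
apply: (eq_measurable_fun (fun y => y `^ (-1))).
  move=> y /set_mem/D0; rewrite /= in_itv/= andbT => y0.
  by rewrite powR_inv1// ltW.
by apply: measurable_funTS; exact: measurable_powR.
Qed.

Lemma integral_inv_co (a b : R) : 0 < a -> a < b ->
  (\int[leb]_(y in `[a, b[) (y^-1)%:E = (ln b - ln a)%:E)%E.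
Proof.
move=> a0 ab; rewrite -integral_inv_cc// integral_itv_bndo_bndc//.
apply: measurable_inv => // y /=; rewrite !in_itv/= => /andP[ay _].
by rewrite andbT (lt_le_trans a0).
Qed.

Lemma integral_inv_oo (a b : R) : 0 < a -> a < b ->
  (\int[leb]_(y in `]a, b[) (y^-1)%:E = (ln b - ln a)%:E)%E.
Proof.
move=> a0 ab; rewrite -integral_inv_co// integral_itv_obnd_cbnd//.
apply: measurable_inv => // y /=; rewrite !in_itv/= => /andP[ay _].
by rewrite andbT (lt_trans a0).
Qed.

Definition box d (A : 'I_d -> set (measurableTypeR R)) :
    set (d.-tuple (measurableTypeR R)) :=
  [set x | forall i, A i (tnth x i)].

Lemma measurable_box d (A : 'I_d -> set (measurableTypeR R)) :
  (forall i, measurable (A i)) -> measurable (box A).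
Proof.
move=> mA; have -> : box A = \bigcap_(i in [set: 'I_d])
    ((fun x : d.-tuple (measurableTypeR R) => tnth x i) @^-1` A i).
  by apply/seteqP; split => [x Ax i _|x Ax i]; [exact: Ax|exact: (Ax i)].
apply: fin_bigcap_measurable => // i _; rewrite -[X in measurable X]setTI.
by apply: (@measurable_tnth _ (measurableTypeR R) d i) => //; exact: mA.
Qed.

Lemma lebesgue_tuple_box d (A : 'I_d -> set (measurableTypeR R)) :
  (forall i, measurable (A i)) ->
  (lebesgue_tuple d (box A) = \prod_(i < d) leb (A i))%E.
Proof.
elim: d A => [|d IH] A mA.
  rewrite big_ord0 /= diracE mem_set// => -[]//.
rewrite big_ord_recl -IH//=.
have -> : pushforward (leb \x lebesgue_tuple d)%E (@cons_pair R d) (box A) =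
    (leb \x lebesgue_tuple d)%E (A ord0 `*` box (fun i => A (lift ord0 i))).
  rewrite /pushforward; congr (_ _); apply/seteqP; split => -[t x] /=.
    move=> h; split => [|i]; first exact: (h ord0).
    by have := h (lift ord0 i); rewrite tnthS.
  move=> [h0 h] i; case: (unliftP ord0 i) => [j|] ->; last exact: h0.
  by rewrite tnthS; exact: h.
by rewrite product_measure1E//; exact: measurable_box.
Qed.

Lemma rhoE d (Q : set (d.-tuple (measurableTypeR R))) (J : set R) :
  measurable Q -> measurable J -> J `<=` `]0, +oo[ ->
  (rho (Q `*` J : set (axb_space R d)) =
   lebesgue_tuple d Q * \int[leb]_(y in J) (y^-1)%:E)%E.
Proof.
move=> mQ mJ J0.
have mJ' : measurable (J : set (measurableTypeR R)) by [].
rewrite /rho setIidl; last first.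
  by move=> [x y] [/= _ /J0]; rewrite /= in_itv/= andbT.
pose f (z : axb_space R d) : \bar R :=
  ((\1_Q z.1 : R)%:E * ((fun y : R => (y^-1)%:E) \_ J) z.2)%E.
have mg : measurable_fun setT ((fun y : measurableTypeR R => (y^-1)%:E) \_ J).
  by apply/(measurable_restrictT _ mJ'); exact: measurable_inv.
have g0 y : (0 <= ((fun y : R => (y^-1)%:E) \_ J) y)%E.
  rewrite patchE; case: ifPn => // /set_mem/J0; rewrite /= in_itv/= andbT.
  by rewrite lee_fin invr_ge0 => /ltW.
transitivity (\int[lebesgue_tuple d \x leb]_z f z)%E.
  rewrite integral_mkcond; apply: eq_integral => -[x y] _.
  rewrite /f /= !patchE in_setX indicE.
  by case: (x \in Q) => /=; rewrite ?mul1e ?mul0e.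
rewrite fubini_tonelli1//; last 2 first.
- apply: emeasurable_funM.
    by apply/measurable_EFinP; apply: measurableT_comp => //; exact: measurable_indic.
  exact: (measurableT_comp mg measurable_snd).
- by move=> z; rewrite mule_ge0.
rewrite /fubini_F /f /=.
have Z x : (\int[leb]_y ((\1_Q x : R)%:E * ((fun y => (y^-1)%:E) \_ J) y) =
    (\1_Q x)%:E * \int[leb]_(y in J) (y^-1)%:E)%E.
  rewrite [in RHS]integral_mkcond; exact: ge0_integralZl.
under eq_integral do rewrite Z.
rewrite ge0_integralZr//; last 2 first.
- exact/measurable_EFinP/measurable_indic.
- apply: integral_ge0 => y /J0; rewrite /= in_itv/= andbT.
  by rewrite lee_fin invr_ge0 => /ltW.
by rewrite integral_indic// setIT.
Qed.

End haar_measure_of_boxes.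

(** * Half-open dyadic intervals *)

Section dyadic_intervals.
Context {R : realType}.
Implicit Types (s x : R) (m : int).

(** Half-open, unlike the factors of [dyadic_cube], so that the two halves lose no midpoint. *)
Definition dyadic s m x : bool := m%:~R * s <= x < (m + 1)%:~R * s.

Lemma dyadic_half s m (b : bool) x : 0 < s ->
  dyadic (s / 2) (2 * m + b%:Z) x =
  dyadic s m x && (b == (m%:~R * s + s / 2 <= x)).
Proof.
move=> s0; rewrite /dyadic !intrD intrM; have [h|h] := leP (m%:~R * s + s / 2) x;
  case: b => /=; rewrite ?andbT ?andbF;
  (try by apply/idP/idP => /andP[h1 h2]; apply/andP; split; lra);
  by apply/negbTE/negP => /andP[h1 h2]; lra.
Qed.

Lemma dyadic_split s m x : 0 < s -> dyadic s m x ->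
  dyadic (s / 2) (2 * m + (m%:~R * s + s / 2 <= x)%R%:Z) x.
Proof. by move=> s0 h; rewrite dyadic_half// h eqxx. Qed.

End dyadic_intervals.

(** * The admissibility bounds when the interval is halved *)

Section admissible_scales.
Context {R : realType}.
Variable beta : R.
Hypothesis hbeta : 1 + ln 2 < beta.
Implicit Types s t x : R.

(** The bounds on the side of an admissible cube in the coordinates [t = ln a0] and [s = ln r]; the
    case [1 <= s] is [e <= r]. *)
Definition scale_low t s : R :=
  if 1 <= s then expR (t / 2 + s * beta) else expR (t / 2) * s.

Definition scale_up t s : R :=
  if 1 <= s then expR (t / 2 + 4 * s * beta) else expR (4 * beta + t / 2) * s.

(** A crude bound, sufficient to absorb the factor [expR (s / 4)] with [s < 1] into a factor 2. *)
Lemma ln2_ge : 1 / 4 <= ln 2 :> R.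
Proof.
rewrite -ler_expR lnK ?posrE//.
have := expR_ge1Dx (- (1 / 4) : R); rewrite expRN => h.
have e0 := expR_gt0 (1 / 4 : R).
have : (1 + - (1 / 4)) * expR (1 / 4) <= 1 :> R.
  by rewrite -ler_pdivlMr// [leRHS]div1r.
lra.
Qed.

(** Halving the interval moves its center by [s / 2], so [expR (t / 2)] grows at most by the factor
    [expR (s / 4)]. The smaller exponent [s * beta], or the halved factor [s], compensates for
    this. *)
Lemma scale_low_half t t' s : 0 < s -> t - s / 2 <= t' <= t + s / 2 ->
  scale_low t' (s / 2) <= scale_low t s.
Proof.
move=> s0 /andP[h1 h2]; have l2 := ln2_ge.
have b1 : 1 < beta by have := hbeta; lra.
have sb : s < s * beta by rewrite ltr_pMr.
rewrite /scale_low; case: (leP 1 (s / 2)) => s2.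
  by rewrite ifT; [rewrite ler_expR; lra|lra].
case: (leP 1 s) => s1.
  apply: (@le_trans _ _ (expR (t' / 2) * 1)).
    by rewrite ler_pM2l ?expR_gt0// ltW.
  by rewrite mulr1 ler_expR; lra.
have : expR (t' / 2) <= expR (t / 2) * 2.
  have -> : expR (t / 2) * 2 = expR (t / 2 + ln 2) by rewrite expRD lnK ?posrE.
  by rewrite ler_expR; lra.
move=> h; rewrite mulrA -(mulrA _ _ 2^-1) mulrA.
by rewrite ler_pdivrMr// mulrAC ler_wpM2r// ltW.
Qed.

(** The interval is cut only when the side is below twice the lower bound, so this keeps the side
    below the new upper bound. For large [s] the exponent [4 * s * beta] becomes [2 * s * beta],
    still exceeding [s * beta] by enough for the factor 2 and the moved center; for smaller [s] the
    slack is [expR (4 * beta)]. *)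
Lemma scale_up_half t t' s : 0 < s -> t - s / 2 <= t' <= t + s / 2 ->
  scale_low t s * 2 <= scale_up t' (s / 2).
Proof.
move=> s0 /andP[h1 h2]; have l2 := ln2_ge.
have b1 : 1 < beta by have := hbeta; lra.
have b0 : 0 < beta by lra.
have hb := hbeta.
have sb : s * (1 + ln 2) < s * beta by rewrite ltr_pM2l.
have E2 x : expR x * 2 = expR (x + ln 2) by rewrite expRD lnK ?posrE.
rewrite /scale_low /scale_up; case: (leP 1 (s / 2)) => s2.
  rewrite ifT; last lra.
  rewrite E2 ler_expR.
  have : ln 2 <= s * ln 2 by rewrite ler_peMl; lra.
  lra.
case: (leP 1 s) => s1.
  have sb2 : s * beta <= 2 * beta by rewrite ler_pM2r//; lra.
  rewrite E2; apply: (@le_trans _ _ (expR (4 * beta + t' / 2) * 2^-1)).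
    by rewrite ler_pdivlMr// E2 ler_expR; lra.
  by rewrite ler_pM2l ?expR_gt0//; lra.
have h : expR (t / 2) * 2 * 2 <= expR (4 * beta + t' / 2).
  by rewrite !E2 ler_expR; lra.
by rewrite [leRHS]mulrA ler_pdivlMr// -!(mulrAC _ _ s) ler_pM2r.
Qed.

(** With [scale_up_le], this compares the admissibility bounds with multiples of [s], uniformly
    while [t] and [s] stay bounded. *)
Lemma scale_low_ge t s : 0 < s -> expR (t / 2) * s <= scale_low t s.
Proof.
move=> s0; rewrite /scale_low; case: ifP => // s1.
rewrite expRD ler_pM2l ?expR_gt0//.
have b1 : 1 < beta by have := hbeta; have := ln2_ge; lra.
apply: (@le_trans _ _ (s * beta)); first by rewrite ler_peMr// ltW.
by apply: le_trans (expR_ge1Dx _); lra.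
Qed.

Lemma scale_up_le t s S : 0 < s -> s <= S -> 1 <= S ->
  scale_up t s <= expR (4 * S * beta + t / 2) * s.
Proof.
move=> s0 sS S1; have b0 : 0 < beta by have := hbeta; have := ln2_ge; lra.
rewrite /scale_up; case: ifP => s1.
  apply: (@le_trans _ _ (expR (4 * S * beta + t / 2) * 1)).
    by rewrite mulr1 ler_expR addrC lerD2r ler_pM2r//; lra.
  by rewrite ler_pM2l ?expR_gt0.
rewrite ler_pM2r// ler_expR lerD2r ler_pM2r//; lra.
Qed.

End admissible_scales.

(** * Cells, their Haar measure and their subdivision *)

Section cells.
Context {R : realType} {d : nat}.
Variables (beta alpha L : R).
Hypotheses (hd : (0 < d)%N) (hbeta : 1 + ln 2 < beta) (L0 : 0 < L).
Local Notation rho := (@rho R d).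

(* The cell (k, m, n, j) stands for the product of the half-open dyadic cube
   of side 2^k with corner 2^k m and the j-th interval, in the variable
   ln a - alpha, of length L / 2^n. *)
Definition cell : choiceType := (int * d.-tuple int * nat * int)%type.

Definition side (c : cell) : R := 2 ^ c.1.1.1.
Definition width (c : cell) : R := L / 2 ^+ c.1.2.
Definition center (c : cell) : R := alpha + c.2%:~R * width c + width c / 2.

(** Positivity is required separately because [ln] takes the value 0 on nonpositive reals. *)
Definition region (c : cell) : set (axb_space R d) :=
  [set z | (forall i, dyadic (side c) (tnth c.1.1.2 i) (tnth z.1 i)) /\
    0 < (z.2 : R) /\ dyadic (width c) c.2 (ln (z.2 : R) - alpha)].

(** [center c] is [ln a0] and half the width is [ln r]. The condition on the index keeps the cell
    over the interval of the root, which bounds all centers. *)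
Definition admissible_cell (c : cell) : Prop :=
  scale_low beta (center c) (width c / 2) <= side c <
    scale_up beta (center c) (width c / 2) /\
  0 <= c.2 < 2 ^+ c.1.2.

Definition cube_child (c : cell) (e : d.-tuple bool) : cell :=
  (c.1.1.1 - 1, [tuple 2 * tnth c.1.1.2 i + (tnth e i)%:Z | i < d], c.1.2, c.2).

Definition width_child (c : cell) (b : bool) : cell :=
  (c.1.1.1, c.1.1.2, c.1.2.+1, 2 * c.2 + b%:Z).

(** A halved cube inherits the upper bound, so only the lower one is tested. Cutting the cube has
    priority: an interval is cut only if [side c] is below twice the lower bound. *)
Definition children (c : cell) : seq cell :=
  if scale_low beta (center c) (width c / 2) <= side c / 2
  then [seq cube_child c e | e <- enum {: d.-tuple bool}]
  else [seq width_child c b | b <- enum {: bool}].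

Lemma side_gt0 c : 0 < side c.
Proof. exact: exprz_gt0. Qed.

Lemma width_gt0 c : 0 < width c.
Proof. by rewrite divr_gt0// exprn_gt0. Qed.

Lemma side_cube_child c e : side (cube_child c e) = side c / 2.
Proof. by rewrite /side /= expfzDr// exprN1. Qed.

Lemma width_width_child c b : width (width_child c b) = width c / 2.
Proof. by rewrite /width /= exprSr invfM mulrA. Qed.

Lemma dyadic_ln w j y : 0 < w ->
  0 < y /\ dyadic w j (ln y - alpha) <->
  expR (alpha + j%:~R * w) <= y < expR (alpha + (j + 1)%:~R * w).
Proof.
move=> w0; split.
  move=> [y0 /andP[h1 h2]].
  by rewrite -(lnK (_ : y \is Num.pos))// ler_expR ltr_expR; apply/andP; split; lra.
move=> /andP[h1 h2]; have y0 : 0 < y by apply: lt_le_trans h1; exact: expR_gt0.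
split => //; move: h1 h2; rewrite -{1 2}(lnK (_ : y \is Num.pos))//.
by rewrite ler_expR ltr_expR => h1 h2; apply/andP; split; lra.
Qed.

Lemma regionE c : region c =
  box (fun i => `[(tnth c.1.1.2 i)%:~R * side c,
                  (tnth c.1.1.2 i + 1)%:~R * side c[%classic) `*`
  `[expR (alpha + c.2%:~R * width c), expR (alpha + (c.2 + 1)%:~R * width c)[%classic.
Proof.
apply/seteqP; split => -[x y] /=.
  move=> [h /(dyadic_ln _ _ (width_gt0 c)) h2]; split; last by rewrite in_itv.
  by move=> i /=; rewrite in_itv; exact: h.
move=> [h]; rewrite in_itv => h2; split => [i|].
  by have /= := h i; rewrite in_itv.
exact/(dyadic_ln _ _ (width_gt0 c)).
Qed.

(** The sets of the definition of atoms are open; they differ from the cells by null sets. *)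
Definition open_region (c : cell) : set (axb_space R d) :=
  dyadic_cube c.1.1.1 c.1.1.2 `*`
  `]expR (alpha + c.2%:~R * width c), expR (alpha + (c.2 + 1)%:~R * width c)[%classic.

Lemma open_regionE c : open_region c =
  box (fun i => `](tnth c.1.1.2 i)%:~R * side c,
                  (tnth c.1.1.2 i + 1)%:~R * side c[%classic) `*`
  `]expR (alpha + c.2%:~R * width c), expR (alpha + (c.2 + 1)%:~R * width c)[%classic.
Proof.
congr (_ `*` _); apply/seteqP; split => x h i.
  by have := h i; rewrite /= in_itv/= intrD.
by have := h i; rewrite /= in_itv/= intrD.
Qed.

Let expR_lt c : expR (alpha + c.2%:~R * width c) <
  expR (alpha + (c.2 + 1)%:~R * width c).
Proof. by rewrite ltr_expR ltrD2l ltr_pM2r ?width_gt0// ltr_int ltrDl. Qed.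

Let side_lt c i : (tnth c.1.1.2 i)%:~R * side c <
  (tnth c.1.1.2 i + 1)%:~R * side c.
Proof. by rewrite ltr_pM2r ?side_gt0// ltr_int ltrDl. Qed.

Let prod_side c :
  (\prod_(i < d) (((tnth c.1.1.2 i + 1)%:~R * side c)%:E -
    ((tnth c.1.1.2 i)%:~R * side c)%:E) = (side c ^+ d)%:E)%E.
Proof.
under eq_bigr do rewrite -EFinB -mulrBl intrD [X in (X * _)%:E]addrC addKr mul1r.
by rewrite -[in RHS](card_ord d) -prodr_const prodEFin.
Qed.

Let haar_width c : ln (expR (alpha + (c.2 + 1)%:~R * width c)) -
  ln (expR (alpha + c.2%:~R * width c)) = width c.
Proof. by rewrite !expRK intrD; ring. Qed.

Lemma measurable_region c : measurable (region c).
Proof.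
rewrite regionE; apply: measurableX => //.
by apply: measurable_box => i.
Qed.

Lemma measurable_open_region c : measurable (open_region c).
Proof.
rewrite open_regionE; apply: measurableX => //.
by apply: measurable_box => i.
Qed.

(** The density [a^-1] makes the measure Lebesgue in [ln a], so the mass depends on side and width
    only, not on the position of the cell. *)
Lemma rho_region c : rho (region c) = (side c ^+ d * width c)%:E.
Proof.
rewrite regionE rhoE//.
- rewrite lebesgue_tuple_box//; under eq_bigr do
    rewrite lebesgue_measure_itv/= lte_fin side_lt.
  by rewrite prod_side integral_inv_co ?expR_gt0// haar_width.
- by apply: measurable_box => i.
- move=> y /=; rewrite !in_itv/= andbT => /andP[h _].
  by apply: lt_le_trans h; exact: expR_gt0.
Qed.

Lemma rho_open_region c : rho (open_region c) = (side c ^+ d * width c)%:E.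
Proof.
rewrite open_regionE rhoE//.
- rewrite lebesgue_tuple_box//; under eq_bigr do
    rewrite lebesgue_measure_itv/= lte_fin side_lt.
  by rewrite prod_side integral_inv_oo ?expR_gt0// haar_width.
- by apply: measurable_box => i.
- move=> y /=; rewrite !in_itv/= andbT => /andP[h _].
  by apply: lt_trans h; exact: expR_gt0.
Qed.

Lemma open_region_sub c : open_region c `<=` region c.
Proof.
rewrite open_regionE regionE => -[x y] [/= hx hy]; split => /= [i|].
  have := hx i; rewrite /= !in_itv/= => /andP[h1 h2].
  by rewrite ltW.
by move: hy; rewrite !in_itv/= => /andP[h1 h2]; rewrite ltW.
Qed.

Lemma rho_regionD c : rho (region c `\` open_region c) = 0%E.
Proof.
have roo : (rho (region c) < +oo)%E by rewrite rho_region ltry.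
have h := measureD (measurable_region c) (measurable_open_region c) roo.
apply: (etrans h); rewrite (setIidr (@open_region_sub c)).
apply: (etrans (congr2 _ (rho_region c) (congr1 _ (rho_open_region c)))).
by rewrite -EFinB subrr.
Qed.

Lemma indic_sum_disjoint (I : finType) (P : set (axb_space R d))
    (C : I -> set (axb_space R d)) z :
  (forall i, C i `<=` P) ->
  (P z -> exists2 i, C i z & forall j, C j z -> j = i) ->
  \1_P z = \sum_(i : I) \1_(C i) z :> R.
Proof.
move=> CP Pz; have [zP|zP] := pselect (P z).
  have [i Ci uniq_i] := Pz zP; rewrite (bigD1 i)//= big1 => [|j ji].
    by rewrite addr0 !indicE !mem_set.
  by rewrite indicE memNset// => /uniq_i ij; rewrite ij eqxx in ji.
rewrite indicE memNset// big1// => i _; rewrite indicE memNset// => /CP //.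
Qed.

Lemma indic_cell_children c z :
  \1_(region c) z = \sum_(C <- children c) \1_(region C) z :> R.
Proof.
have s0 := side_gt0 c; have w0 := width_gt0 c.
rewrite /children; case: ifP => _.
  rewrite big_map big_enum/=; apply: indic_sum_disjoint.
    move=> e y [h1 h2]; split => // i; have := h1 i.
    by rewrite side_cube_child tnth_mktuple dyadic_half// => /andP[].
  move=> [h1 h2].
  exists [tuple ((tnth c.1.1.2 i)%:~R * side c + side c / 2 <= tnth z.1 i)%R | i < d].
    split => // i; rewrite side_cube_child !tnth_mktuple.
    by apply: dyadic_split => //; exact: h1.
  move=> e [h3 _]; apply: eq_from_tnth => i; have := h3 i.
  by rewrite side_cube_child !tnth_mktuple dyadic_half// => /andP[_ /eqP].
rewrite big_map big_enum/=; apply: indic_sum_disjoint.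
  move=> e y [h1 [h2 h3]]; split => //; split => //; move: h3.
  by rewrite width_width_child dyadic_half// => /andP[].
move=> [h1 [h2 h3]].
exists (c.2%:~R * width c + width c / 2 <= ln (z.2 : R) - alpha).
  split => //; split => //; rewrite width_width_child.
  exact: dyadic_split.
by move=> e [_ [_]]; rewrite width_width_child dyadic_half// => /andP[_ /eqP].
Qed.

Lemma center_width_child c b : let s := width c / 2 in
  center c - s / 2 <= center (width_child c b) <= center c + s / 2.
Proof.
rewrite /= /center width_width_child /= intrD intrM; have w0 := width_gt0 c.
by case: b => /=; apply/andP; split; lra.
Qed.

Lemma admissible_children c C : admissible_cell c -> C \in children c ->
  admissible_cell C.
Proof.
move=> [/andP[h1 h2] h3]; have s0 := side_gt0 c; have w0 := width_gt0 c.
rewrite /children; case: ifPn => [h /mapP[e _ ->]|h /mapP[b _ ->]].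
  split => //; rewrite side_cube_child; apply/andP; split => //.
  by apply: le_lt_trans h2; lra.
have cc := center_width_child c b.
have w2 : 0 < width c / 2 by rewrite divr_gt0.
split.
  rewrite width_width_child; apply/andP; split.
    apply: le_trans h1.
    by apply: scale_low_half.
  apply: (@lt_le_trans _ _ (scale_low beta (center c) (width c / 2) * 2)).
    by rewrite -ltr_pdivrMr// ltNge.
  by apply: scale_up_half.
move: h3; rewrite /= exprS; move: (2 ^+ c.1.2) (c.2) => N j /andP[j0 jN].
by case: b {cc}; lia.
Qed.

(** Cutting the cube divides the mass by [2 ^+ d], cutting the interval by 2, which is at most
    [2 ^+ d] since [0 < d]. *)
Lemma cell_subdivision :
  subdivision rho region children admissible_cell (2 ^+ d).
Proof.
have mE c : fine (rho (region c)) = side c ^+ d * width c by rewrite rho_region.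
split.
- exact: measurable_region.
- move=> c; have h : (rho (region c) < +oo)%E by rewrite rho_region ltry.
  exact: h.
- by move=> c _; rewrite mE mulr_gt0 ?exprn_gt0 ?side_gt0 ?width_gt0.
- exact: admissible_children.
- by move=> c z _; exact: indic_cell_children.
- move=> c C _; have s0 := side_gt0 c; have w0 := width_gt0 c.
  rewrite !mE /children; case: ifP => _ /mapP[e _ ->].
    rewrite side_cube_child expr_div_n.
    suff -> : 2 ^+ d * (side c ^+ d / 2 ^+ d * width c) =
      side c ^+ d * width c by [].
    by field; rewrite expf_neq0.
  rewrite width_width_child [leRHS]mulrCA ler_pM2l ?exprn_gt0//.
  rewrite [leRHS]mulrCA ler_peMr ?(ltW w0)// ler_pdivlMr// mul1r.
  by rewrite -[X in X <= _]expr1 ler_weXn2l// ler1n.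
Qed.

End cells.

(** * Generators of the measurable sets of the space *)

Lemma sigma_algebra_preimage_borel {R : realType} {T : Type}
    (G : set (set T)) (f : T -> R) : sigma_algebra setT G ->
  (forall c, G [set z | f z < c]) ->
  forall B : set (measurableTypeR R), measurable B -> G (f @^-1` B).
Proof.
move=> [G0 GC GU] Gf B mB.
have {}mB : (@RGenInftyO.G R).-sigma.-measurable B.
  by rewrite -RGenInftyO.measurableE.
move: B mB; apply: smallest_sub.
  split => [|A GA|F GF] /=.
  - by rewrite preimage_set0.
  - by rewrite setTD preimage_setC -setTD; exact: GC.
  - by rewrite preimage_bigcup; exact: GU.
move=> _ [c ->] /=; rewrite (_ : _ @^-1` _ = [set z | f z < c]); first exact: Gf.
by apply/seteqP; split => z /=; rewrite in_itv.
Qed.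

(** The coordinates generate the product sigma-algebra and the open rays the Borel sets of the line,
    so properties stable under sigma-algebra operations need only be checked on half-spaces. *)
Lemma axb_space_measurable_ind {R : realType} {d : nat}
    (G : set (set (axb_space R d))) : sigma_algebra setT G ->
  (forall i c, G [set z | (tnth z.1 i : R) < c]) ->
  (forall c, G [set z | (z.2 : R) < c]) ->
  forall A, measurable A -> G A.
Proof.
move=> sG Gx Gy; have [G0 GC GU] := sG.
apply: smallest_sub => // A [] [B mB <-]; rewrite setTI.
- move: B mB; apply: smallest_sub.
    split => [|B GB|F GF] /=.
    + by rewrite preimage_set0.
    + by rewrite setTD preimage_setC -setTD; exact: GC.
    + by rewrite preimage_bigcup; exact: GU.
  move=> B; rewrite -bigcup_seq => -[i _] [C mC <-].
  rewrite setTI -comp_preimage.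
  apply: (@sigma_algebra_preimage_borel _ _ G
    (fun z : axb_space R d => tnth z.1 i)) => //.
- by apply: (@sigma_algebra_preimage_borel _ _ G (fun z : axb_space R d => z.2)).
Qed.

Lemma measurable_coordinate_lt {R : realType} {d : nat} i (r : R) :
  measurable [set z : axb_space R d | (tnth z.1 i : R) < r].
Proof.
rewrite -[X in measurable X]setTI.
have -> : [set z : axb_space R d | (tnth z.1 i : R) < r] =
    (fun z : axb_space R d => tnth z.1 i) @^-1` `]-oo, r[%classic.
  by apply/seteqP; split => x /=; rewrite in_itv.
by apply: (measurableT_comp (measurable_tnth i) measurable_fst).
Qed.

Lemma measurable_height_lt {R : realType} {d : nat} (r : R) :
  measurable [set z : axb_space R d | (z.2 : R) < r].
Proof.
rewrite -[X in measurable X]setTI.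
have -> : [set z : axb_space R d | (z.2 : R) < r] =
    (fun z : axb_space R d => z.2) @^-1` `]-oo, r[%classic.
  by apply/seteqP; split => x /=; rewrite in_itv.
by apply: measurable_snd.
Qed.

(** * Shrinking of the cells, and settledness of all measurable sets *)

Section cells_generate.
Context {R : realType} {d : nat}.
Variables (beta alpha L : R).
Hypotheses (hd : (0 < d)%N) (hbeta : 1 + ln 2 < beta) (L0 : 0 < L).
Local Notation rho := (@rho R d).
Local Notation cell := (@cell d).
Local Notation side := (@side R d).
Local Notation width := (@width R d L).
Local Notation center := (@center R d alpha L).
Local Notation region := (@region R d alpha L).
Local Notation children := (@children R d beta alpha L).
Local Notation admissible_cell := (@admissible_cell R d beta alpha L).
Local Notation generation := (generation children).
Local Notation settled := (settled rho region children).
Implicit Types c C : cell.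

Let S := cell_subdivision alpha hd hbeta L0.

(** Either kind of cut halves exactly one of the two factors. *)
Lemma side_width_generation N c C : C \in generation N c ->
  side C * width C = side c * width c / 2 ^+ N.
Proof.
elim: N c => [|N IH] c /=; first by rewrite inE => /eqP ->; rewrite expr0 divr1.
move=> /flatten_mapP[D Dc /IH ->].
have -> : side D * width D = side c * width c / 2.
  move: Dc; rewrite /children; case: ifP => _ /mapP[e _ ->].
    by rewrite side_cube_child mulrAC.
  by rewrite width_width_child mulrA.
by rewrite exprS invfM [in RHS]mulrA.
Qed.

Lemma width_le c : width c <= L.
Proof. by rewrite ler_pdivrMr ?exprn_gt0// ler_peMr ?(ltW L0)// exprn_ege1// ler1n. Qed.

Lemma center_bounds c : admissible_cell c -> alpha <= center c <= alpha + L.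
Proof.
move=> [_ /andP[j0 jn]]; have w0 := width_gt0 L0 c.
have wL : width c * 2 ^+ c.1.2 = L by rewrite mulfVK// expf_neq0.
have h0 : 0 <= c.2%:~R * width c by rewrite mulr_ge0 ?ler0z// ltW.
have h1 : (c.2 + 1)%:~R * width c <= L.
  apply: (@le_trans _ _ (width c * 2 ^+ c.1.2)); last by rewrite wL.
  rewrite mulrC ler_pM2l//.
  have -> : 2 ^+ c.1.2 = (2 ^+ c.1.2 : int)%:~R :> R by rewrite rmorphXn.
  by rewrite ler_int lezD1.
rewrite intrD mulrDl mul1r in h1.
by rewrite /center; apply/andP; split; lra.
Qed.

(** Centers and widths are bounded within one tree, so both admissibility bounds are comparable with
    the width. This forces cubes and intervals to shrink together. *)
Lemma side_width_comparable : exists c1 c2 : R, [/\ 0 < c1, 0 < c2 &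
  forall c, admissible_cell c -> c1 * width c <= side c <= c2 * width c].
Proof.
pose M := 1 + L.
exists (expR (alpha / 2) / 2), (expR (4 * M * beta + (alpha + L) / 2) / 2).
split; [by rewrite divr_gt0 ?expR_gt0..|].
move=> c ac; have /andP[a1 a2] := center_bounds ac.
have [/andP[h1 h2] _] := ac; have w0 := width_gt0 L0 c.
have w2 : 0 < width c / 2 by rewrite divr_gt0.
have wL := width_le c.
rewrite -!mulrA ![2^-1 * _]mulrC; apply/andP; split.
  apply: le_trans h1; apply: le_trans (scale_low_ge hbeta _ w2).
  by rewrite ler_pM2r// ler_expR; lra.
apply: (le_trans (ltW h2)); apply: (le_trans (@scale_up_le _ _ hbeta _ _ M _ _ _)) => //.
- by rewrite /M; lra.
- by rewrite /M; have := L0; lra.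
- by rewrite ler_pM2r// ler_expR; lra.
Qed.

Lemma generation_small c eps : admissible_cell c -> 0 < eps ->
  exists N0, forall N C, (N0 <= N)%N -> C \in generation N c ->
    side C <= eps /\ width C <= eps.
Proof.
move=> ac e0; have [c1 [c2 [c10 c20 h]]] := side_width_comparable.
(* By comparability the squares of side and width are at most [c2] and [c1^-1] times their product;
   both are at most [eps ^+ 2] once the product is at most [D]. *)
pose D := eps ^+ 2 / (c1^-1 + c2).
have s0 : 0 < c1^-1 + c2 by rewrite addr_gt0 ?invr_gt0.
have D0 : 0 < D by rewrite divr_gt0 ?exprn_gt0.
have K0 : 0 < side c * width c by rewrite mulr_gt0 ?side_gt0 ?width_gt0.
have [N0 hN0] : exists N0 : nat, side c * width c / D <= 2 ^+ N0.
  pose n := Num.Def.truncn (side c * width c / D).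
  exists n.+1; apply: (@le_trans _ _ n.+1%:R).
    by apply/ltW; rewrite truncnS_gt.
  by rewrite -natrX ler_nat ltnW// ltn_expl.
exists N0 => N C N0N CN; have aC := generation_ok S ac CN.
have /andP[h1 h2] := h _ aC.
have sC := side_gt0 (R := R) C; have wC := width_gt0 L0 C.
have sw : side C * width C <= D.
  rewrite (side_width_generation CN) ler_pdivrMr ?exprn_gt0//.
  rewrite [leRHS]mulrC -ler_pdivrMr//; apply: (le_trans hN0).
  by rewrite ler_weXn2l// ler1n.
have DE : D * (c1^-1 + c2) = eps ^+ 2 by rewrite mulfVK// gt_eqF.
have swp : 0 < side C * width C by rewrite mulr_gt0.
split.
  rewrite -(@ler_pXn2r _ 2) ?nnegrE ?(ltW sC) ?(ltW e0)// -DE expr2.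
  apply: (@le_trans _ _ (side C * (c2 * width C))); first by rewrite ler_pM2l.
  rewrite mulrCA mulrC; apply: (le_trans (ler_wpM2r (ltW c20) sw)).
  by rewrite ler_pM2l// lerDr invr_ge0 ltW.
rewrite -(@ler_pXn2r _ 2) ?nnegrE ?(ltW wC) ?(ltW e0)// -DE expr2.
apply: (@le_trans _ _ (side C * width C * c1^-1)).
  by rewrite [leRHS]mulrAC ler_pM2r// ler_pdivlMr// [leLHS]mulrC.
apply: (le_trans (ler_wpM2r _ sw)); first by rewrite invr_ge0 ltW.
by rewrite ler_pM2l// lerDl ltW.
Qed.

Lemma dyadic_ray s m (J : int) : 0 < s ->
  (forall x : R, dyadic s m x -> x < J%:~R * s) \/
  (forall x : R, dyadic s m x -> ~ x < J%:~R * s).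
Proof.
move=> s0; have [Jm|mJ] := leP J m.
  right => x /andP[mx _]; apply/negP; rewrite -leNgt; apply: le_trans mx.
  by rewrite ler_pM2r// ler_int.
left => x /andP[_ xm]; apply: (lt_le_trans xm).
by rewrite ler_pM2r// ler_int lezD1.
Qed.

(** Fine cells resolve rays ending on a dyadic grid, and every open ray is a countable union of
    these. The unit [e] is 1 for the cubes and [L] for the heights. *)
Let dyadic_approx (e c : R) : 0 < e ->
  [set x : R | x < c] =
  \bigcup_(p : nat) [set x | x < (Num.floor (c * 2 ^+ p / e))%:~R * (e / 2 ^+ p)].
Proof.
move=> e0; apply/seteqP; split => x /=; last first.
  move=> [p _ /= xp]; apply: (lt_le_trans xp).
  have ep : 0 < e / 2 ^+ p by rewrite divr_gt0 ?exprn_gt0.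
  rewrite -ler_pdivlMr// (le_trans (floor_le _))// invf_div mulrA.
  exact: lexx.
move=> xc; pose n := Num.Def.truncn (e / (c - x)).
have cx : 0 < c - x by rewrite subr_gt0.
exists n.+1 => //=.
have ep : 0 < e / 2 ^+ n.+1 by rewrite divr_gt0 ?exprn_gt0.
have h : e / 2 ^+ n.+1 < c - x.
  rewrite ltr_pdivrMr ?exprn_gt0// mulrC -ltr_pdivrMr//.
  apply: (@lt_le_trans _ _ n.+1%:R); first exact: truncnS_gt.
  by rewrite -natrX ler_nat ltnW// ltn_expl.
have := floorD1_gt (c * 2 ^+ n.+1 / e); rewrite -(ltr_pM2r ep) intrD mulrDl mul1r.
have -> : c * 2 ^+ n.+1 / e * (e / 2 ^+ n.+1) = c.
  by field; rewrite expf_neq0//= gt_eqF.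
lra.
Qed.

Lemma settled_coordinate c i r : admissible_cell c ->
  settled c [set z | (tnth z.1 i : R) < r].
Proof.
move=> ac.
have -> : [set z : axb_space R d | (tnth z.1 i : R) < r] =
    (fun z : axb_space R d => tnth z.1 i : R) @^-1` [set x | x < r] by [].
rewrite (dyadic_approx r ltr01) preimage_bigcup.
apply: (settled_bigcup S) => // p.
have p0 : 0 < 1 / 2 ^+ p :> R by rewrite divr_gt0 ?exprn_gt0.
have [N0 hN0] := generation_small ac p0.
set J := Num.floor _.
apply: (@settled_split _ _ _ _ _ _ _ _ _ N0).
  exact: (measurable_coordinate_lt i (J%:~R * (1 / 2 ^+ p))).
move=> N C N0N CN; have [sC _] := hN0 _ _ N0N CN.
(* Sides are powers of 2, so a side at most [2 ^ (- p)] divides it, and the end of the ray lies on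
   the grid of [C]. *)
have k0 : C.1.1.1 <= - p%:Z.
  rewrite -(ler_eXz2l (ltr1n R 2)) (le_trans sC)// mul1r.
  by rewrite exprnN.
have JE : J%:~R * (1 / 2 ^+ p) = (J * 2 ^+ `|- p%:Z - C.1.1.1|%N)%:~R * side C.
  rewrite intrM -mulrA; congr (_ * _); rewrite rmorphXn /=.
  have -> : 2 ^+ `|- p%:Z - C.1.1.1|%N = 2 ^ (- p%:Z - C.1.1.1) :> R.
    by rewrite exprnP gez0_abs// subr_ge0.
  by rewrite /side -expfzDr// subrK mul1r exprnN.
have [h|h] := dyadic_ray (tnth C.1.1.2 i) (J * 2 ^+ `|- p%:Z - C.1.1.1|%N)
    (side_gt0 (R := R) C); [left|right] => z [h1 _] /=.
  by rewrite JE; apply: h; exact: h1.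
by rewrite JE; apply: h; exact: h1.
Qed.

Lemma settled_height c r : admissible_cell c ->
  settled c [set z | (z.2 : R) < r].
Proof.
(* Cells contain only positive heights, so [r <= 0] leaves nothing; otherwise the half-space is read
   in the variable [ln a], in which cells are dyadic. *)
move=> ac; have [r0|r0] := leP r 0.
  apply: (settled_eq S ac (A := set0)); last exact: settled0.
    exact: measurable_height_lt.
  apply/seteqP; split => [z [] //|z [/= zr [_ [z0 _]]]].
  by move: (lt_le_trans zr r0); rewrite ltNge ltW.
pose w (z : axb_space R d) : R := ln (z.2 : R) - alpha.
apply: (settled_eq S ac (A := w @^-1` [set x | x < ln r - alpha])).
- exact: measurable_height_lt.
- apply/seteqP; split => z /= [h] Pz; split => //; have [_ [z0 _]] := Pz;
    move: h; rewrite /w ltrD2r ltr_ln//.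
rewrite (dyadic_approx (ln r - alpha) L0) preimage_bigcup.
apply: (settled_bigcup S) => // p.
have p0 : 0 < L / 2 ^+ p by rewrite divr_gt0 ?exprn_gt0.
have [N0 hN0] := generation_small ac p0.
set J := Num.floor _.
apply: (@settled_split _ _ _ _ _ _ _ _ _ N0).
  rewrite -[X in measurable X]setTI.
  have mw : measurable_fun setT (w : axb_space R d -> measurableTypeR R).
    apply: measurable_funB => //.
    exact: (measurableT_comp (@measurable_ln R) measurable_snd).
  apply: mw => //.
  have -> : [set x : R | x < J%:~R * (L / 2 ^+ p)] = `]-oo, J%:~R * (L / 2 ^+ p)[%classic.
    by apply/seteqP; split => x /=; rewrite in_itv.
  exact: measurable_itv.
move=> N C N0N CN; have [_ wC] := hN0 _ _ N0N CN.
have k0 : (p <= C.1.2)%N.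
  move: wC; rewrite /width ler_pM2l// lef_pV2 ?posrE ?exprn_gt0//.
  by rewrite ler_eXn2l// ltr1n.
have JE : J%:~R * (L / 2 ^+ p) = (J * 2 ^+ (C.1.2 - p))%:~R * width C.
  rewrite intrM -mulrA; congr (_ * _); rewrite rmorphXn /= /width.
  rewrite -{2}(subnK k0) exprD; field.
  by rewrite !expf_neq0.
have [h|h] := dyadic_ray C.2 (J * 2 ^+ (C.1.2 - p)) (width_gt0 L0 C);
    [left|right] => z [_ [_ h2]] /=.
  by rewrite JE; exact: h.
by rewrite JE; exact: h.
Qed.

Lemma settled_measurable c A : admissible_cell c -> measurable A -> settled c A.
Proof.
move=> ac; apply: axb_space_measurable_ind.
- exact: (settled_algebra S).
- by move=> i r; exact: settled_coordinate.
- by move=> r; exact: settled_height.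
Qed.

End cells_generate.

(** * Atoms *)

Section complex_modulus.
Context {R : realType}.
Local Notation cmod := (@ComplexField.Normc.normc R).
Implicit Types x : R[i].

Lemma cmod_ge0 x : 0 <= cmod x.
Proof. by case: x => a b; exact: sqrtr_ge0. Qed.

Lemma cmod_real (a : R) : cmod (Complex a 0) = `|a|.
Proof. by rewrite /ComplexField.Normc.normc expr0n addr0 sqrtr_sqr. Qed.

Lemma cmod0 : cmod 0 = 0.
Proof. by rewrite cmod_real normr0. Qed.

Lemma cmod_imag (a : R) : cmod (Complex 0 a) = `|a|.
Proof. by rewrite /ComplexField.Normc.normc expr0n add0r sqrtr_sqr. Qed.

Lemma normr_Re_le x : `|complex.Re x| <= cmod x.
Proof.
case: x => a b; rewrite /= -sqrtr_sqr ler_sqrt ?addr_ge0 ?sqr_ge0//.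
by rewrite lerDl sqr_ge0.
Qed.

Lemma normr_Im_le x : `|complex.Im x| <= cmod x.
Proof.
case: x => a b; rewrite /= -sqrtr_sqr ler_sqrt ?addr_ge0 ?sqr_ge0//.
by rewrite lerDr sqr_ge0.
Qed.

Lemma cmod_triangle x y : cmod (x + y) <= cmod x + cmod y.
Proof. exact: (@le_normcD R x y). Qed.

Lemma cmod_le_ReIm x : cmod x <= `|complex.Re x| + `|complex.Im x|.
Proof.
have {1}-> : x = Complex (complex.Re x) 0 + Complex 0 (complex.Im x).
  by case: x => a b; rewrite /GRing.add /= addr0 add0r.
by rewrite (le_trans (cmod_triangle _ _))// cmod_real cmod_imag.
Qed.

End complex_modulus.

(** * Admissible sets as open parts of cells *)

Section admissible_sets_and_cells.
Context {R : realType} {d : nat}.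
Variable beta : R.

Lemma open_region_admissible alpha L (c : @cell d) : 0 < L ->
  admissible_cell beta alpha L c ->
  admissible beta (open_region alpha L c).
Proof.
move=> L0 [/andP[h1 h2] _]; have w0 := width_gt0 L0 c.
set t := center alpha L c in h1 h2.
set s := width L c / 2 in h1 h2.
have s0 : 0 < s by rewrite divr_gt0.
exists c.1.1.1, c.1.1.2, (expR t), (expR s); split.
- exact: expR_gt0.
- by rewrite expR_gt1.
- have -> : expR t / expR s = expR (alpha + c.2%:~R * width L c).
    by rewrite -expRN -expRD; congr expR; rewrite /t /s /center; field.
  have -> // : expR t * expR s = expR (alpha + (c.2 + 1)%:~R * width L c).
  by rewrite -expRD; congr expR; rewrite /t /s /center intrD; field.
- have sq : Num.sqrt (expR t) = expR (t / 2).
    by rewrite -powR12_sqrt ?expR_ge0// -expRM.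
  rewrite ler_expR sq; move: h1 h2; rewrite /scale_low /scale_up /side.
  case: ifP => s1 h1 h2.
    rewrite -!expRM -!expRD; apply/andP; split => //.
    by rewrite (_ : s * (4 * beta) = 4 * s * beta)//; ring.
  by rewrite expRK -expRD h1.
Qed.

(** Every admissible set is the open part of the root of its own tree: the interval, in logarithmic
    coordinates, starts at [ln a0 - ln r] and has length [2 * ln r]. *)
Lemma admissible_open_region (Q : set (axb_space R d)) : admissible beta Q ->
  exists alpha L (c : @cell d),
    [/\ 0 < L, admissible_cell beta alpha L c & Q = open_region alpha L c].
Proof.
move=> [k [m [a0 [r [a00 r1 -> h]]]]].
have r0 : 0 < r by apply: lt_trans r1.
exists (ln a0 - ln r), (2 * ln r), (k, m, 0%N, 0).
have L0 : 0 < 2 * ln r by rewrite mulr_gt0// ln_gt0.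
have wE : width (2 * ln r) ((k, m, 0%N, 0) : @cell d) = 2 * ln r.
  by rewrite /width expr0 divr1.
have cE : center (ln a0 - ln r) (2 * ln r) ((k, m, 0%N, 0) : @cell d) = ln a0.
  by rewrite /center wE /= mul0r; field.
split => //.
- split; last by rewrite /= expr0.
  rewrite cE wE (_ : 2 * ln r / 2 = ln r); last by field.
  have sq : Num.sqrt a0 = expR (ln a0 / 2).
    by rewrite -[in LHS](lnK (_ : a0 \is Num.pos))// -powR12_sqrt ?expR_ge0// -expRM.
  have e1 : (expR 1 <= r) = (1 <= ln r) by rewrite -[in LHS](lnK (_ : r \is Num.pos))// ler_expR.
  move: h; rewrite e1 sq /scale_low /scale_up /side /=.
  have rp x : r `^ x = expR (ln r * x) by rewrite /powR gt_eqF// mulrC.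
  case: ifP => r2.
    by rewrite !rp -!expRD => /andP[h1 h2]; apply/andP; split;
       rewrite // (_ : 4 * ln r * beta = ln r * (4 * beta))//; ring.
  by rewrite expRD.
- rewrite /open_region wE /= mul0r addr0 mul1r.
  have -> : ln a0 - ln r + 2 * ln r = ln a0 + ln r by ring.
  by rewrite !expRD expRN !lnK.
Qed.

End admissible_sets_and_cells.

(** * Passage between complex atoms and real atoms on cells *)

Section atoms_and_real_atoms.
Context {R : realType} {d : nat}.
Variables (beta q : R).
Hypothesis q1 : 1 < q.
Local Notation T := (axb_space R d).
Local Notation rho := (@rho R d).
Local Notation cmod := (@ComplexField.Normc.normc R).
Implicit Types (a : T -> R[i]) (b u : T -> R) (Q : set T).

Let q0 : 0 < q. Proof. by apply: lt_trans q1. Qed.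

Lemma size_condition (m x : R) : 0 < m -> 0 <= x ->
  ((m^-1 * x) `^ q^-1 <= m^-1) = (x <= m `^ (1 - q)).
Proof.
move=> m0 x0; have m1 : 0 <= m^-1 by rewrite invr_ge0 ltW.
have mx : 0 <= m^-1 * x by rewrite mulr_ge0.
have -> : m `^ (1 - q) = m * m^-1 `^ q.
  rewrite powRD ?(gt_eqF m0) ?implybT// (powRr1 (ltW m0)); congr (_ * _).
  by rewrite -(powR_inv1 (ltW m0)) -powRrM mulN1r.
rewrite -ler_pdivrMl//; apply/idP/idP => h.
  have -> : m^-1 * x = ((m^-1 * x) `^ q^-1) `^ q.
    by rewrite -powRrM mulVf ?gt_eqF// powRr1.
  by apply: ge0_ler_powR; rewrite ?nnegrE ?powR_ge0 ?(ltW q0).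
have -> : m^-1 = (m^-1 `^ q) `^ q^-1.
  by rewrite -powRrM mulfV ?gt_eqF// powRr1.
apply: ge0_ler_powR; rewrite ?nnegrE ?powR_ge0 ?invr_ge0 ?(ltW q0)//.
  by rewrite -powRrM mulfV ?gt_eqF// powRr1.
by rewrite -powRrM mulfV ?gt_eqF// powRr1.
Qed.

Lemma measurable_cmod a : L1 a -> measurable_fun setT (cmod \o a).
Proof.
move=> [/measurable_int/measurable_EFinP mr /measurable_int/measurable_EFinP mi].
have -> : cmod \o a = (fun z => (complex.Re (a z) ^+ 2 + complex.Im (a z) ^+ 2) `^ 2^-1).
  apply/funext => z /=; rewrite powR12_sqrt ?addr_ge0 ?sqr_ge0//.
  by case: (a z).
apply: (measurableT_comp (measurable_powR _)).
by apply: measurable_funD; apply: measurable_funX.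
Qed.

Lemma measurable_cmod_powR a : L1 a ->
  measurable_fun setT (fun z => cmod (a z) `^ q).
Proof.
move=> La; have := measurable_norm_powR q (measurable_cmod La).
by under eq_fun do rewrite /= ger0_norm ?cmod_ge0//.
Qed.

Section tree.
Variables (alpha L : R).
Hypothesis L0 : 0 < L.
Local Notation region := (@region R d alpha L).
Local Notation open_region := (@open_region R d alpha L).
Local Notation ok := (@admissible_cell R d beta alpha L).
Local Notation mass c := (fine (rho (region c))).
Implicit Types c : @cell d.

Lemma massE c : rho (open_region c) = (mass c)%:E.
Proof. by rewrite rho_region// rho_open_region. Qed.

Lemma mass_gt0 c : 0 < mass c.
Proof. by rewrite rho_region//= mulr_gt0 ?exprn_gt0 ?side_gt0 ?width_gt0. Qed.

Lemma inv_massE c : ((rho (open_region c))^-1 = ((mass c)^-1)%:E)%E.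
Proof. by rewrite massE inver gt_eqF// mass_gt0. Qed.

Lemma intble_region c : intble rho (\1_(region c)).
Proof.
have h : (rho (region c) < +oo)%E by rewrite rho_region// ltry.
exact: intble_indic (measurable_region _ _ _) h.
Qed.

Lemma atom_sizeP c a : atom_size q%:E (open_region c) a <->
  (\int[rho]_(z in open_region c) (cmod (a z) `^ q)%:E <=
    (mass c `^ (1 - q))%:E)%E.
Proof.
have key (X : \bar R) : (0 <= X)%E ->
    ((((mass c)^-1)%:E * X) `^ q^-1 <= ((mass c)^-1)%:E)%E <->
    (X <= (mass c `^ (1 - q))%:E)%E.
  have m0 := mass_gt0 c; case: X => [x| |//] x0.
    rewrite -EFinM poweR_EFin !lee_fin size_condition//.
  by rewrite mulry gtr0_sg ?invr_gt0// mul1e poweRyr ?invr_eq0 ?gt_eqF.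
rewrite /atom_size inv_massE; apply: key.
by apply: integral_ge0 => z _; rewrite lee_fin powR_ge0.
Qed.

Lemma ae_open_region c (E : zmodType) (f : T -> E) :
  (forall z, ~ region c z -> f z = 0) ->
  {ae rho, forall z, ~ open_region c z -> f z = 0}.
Proof.
move=> h; exists (region c `\` open_region c); split.
- by apply: measurableD; [exact: measurable_region|exact: measurable_open_region].
- exact: rho_regionD.
- move=> z /= hz; split.
    by apply: contrapT => /h fz; apply: hz => _.
  by move=> oz; apply: hz => /(_ oz).
Qed.

Let complex_of b z : R[i] := Complex (b z) 0.

Let L1_complex_of b : intble rho b -> L1 (complex_of b).
Proof. by move=> ib; split => //; exact: intble0. Qed.

Let cintegral_complex_of b : Int rho b = 0 -> cintegral (complex_of b) = 0.
Proof. by move=> Ib; rewrite /cintegral /= -!/(Int _ _) Ib Int0. Qed.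

Lemma real_ooatom_atom b : real_ooatom rho region ok b ->
  atom beta +oo%E (complex_of b).
Proof.
move=> [c okc [mb bM Ib]]; have m0 := mass_gt0 c.
split; first apply: L1_complex_of.
  apply: (le_intble mb bM); apply: intbleZ; exact: intble_region.
exists (open_region c); split.
- exact: open_region_admissible.
- apply: ae_open_region => z zc; rewrite /complex_of; congr Complex.
  apply/normr0_eq0/le_anti; rewrite normr_ge0 andbT.
  by rewrite (le_trans (bM z))// indicE memNset// mulr0.
(* The norm at infinity is defined by cases, being 0 if the whole space has measure 0. *)
- rewrite /atom_size inv_massE Lnorm.unlock; case: ifP => _; last first.
    by rewrite lee_fin invr_ge0 ltW.
  apply/ess_supP; apply: aeW => z /=; rewrite lee_fin ger0_norm ?sqrtr_ge0//.
  rewrite -/(cmod (Complex _ _)) cmod_real (le_trans (bM z))//.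
  by apply: ler_piMr; [rewrite invr_ge0 ltW|rewrite indicE lern1 leq_b1].
- exact: cintegral_complex_of.
Qed.

Lemma real_qatom_intble b : real_qatom rho region ok q b -> intble rho b.
Proof.
move=> [c okc [mb b0 ib ibq Ib]].
apply: (le_intble mb _ (intbleD (intble_region c) ib)) => z /=.
have [zP|zP] := pselect (region c z).
  by rewrite indicE mem_set// le_D1_powR// ltW.
by rewrite b0// normr0 addr_ge0// powR_ge0.
Qed.

Lemma real_qatom_atom b : real_qatom rho region ok q b ->
  atom beta q%:E (complex_of b).
Proof.
move=> ab; have ib := real_qatom_intble ab.
move: ab => [c okc [mb b0 ibq bq Ib]]; have m0 := mass_gt0 c.
split; first exact: L1_complex_of.
exists (open_region c); split.
- exact: open_region_admissible.
- by apply: ae_open_region => z zc; rewrite /complex_of b0.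
- apply/atom_sizeP.
  have E z : cmod (complex_of b z) `^ q = `|b z| `^ q by rewrite cmod_real.
  under eq_integral => z _ do rewrite E.
  apply: (@le_trans _ _ (Int rho (fun z => `|b z| `^ q))%:E); last by rewrite lee_fin.
  rewrite /Int /Rintegral fineK; last first.
    exact: (integrable_fin_num measurableT ibq).
  apply: ge0_subset_integral => //.
  - exact: measurable_open_region.
  - exact/measurable_EFinP/measurable_norm_powR.
- exact: cintegral_complex_of.
Qed.

(** Meant for the real and the imaginary part. Multiplying by the indicator of the open region turns
    the support condition almost everywhere into a pointwise one. *)
Lemma real_part_of_atom (phi : R[i] -> R) a c : ok c -> L1 a ->
  {ae rho, forall z, ~ open_region c z -> a z = 0} ->
  atom_size q%:E (open_region c) a ->
  (forall x, `|phi x| <= cmod x) -> intble rho (phi \o a) ->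
  Int rho (phi \o a) = 0 ->
  exists u, real_qatom rho region ok q u /\ {ae rho, forall z, phi (a z) = u z}.
Proof.
move=> okc La a0 sa phia ia Ia; have m0 := mass_gt0 c.
have mO : measurable (open_region c) by exact: measurable_open_region.
pose u z := phi (a z) * \1_(open_region c) z.
have mu_ : measurable_fun setT u.
  by apply: measurable_funM_indic => //; exact: (intble_measurable ia).
have au : {ae rho, forall z, phi (a z) = u z}.
  apply: filterS a0 => z hz; rewrite /u indicE.
  have [Oz|Oz] := pselect (open_region c z); first by rewrite mem_set// mulr1.
  rewrite memNset// mulr0 hz//; apply/normr0_eq0/le_anti.
  by rewrite normr_ge0 andbT (le_trans (phia _))// cmod0.
have mphi : measurable_fun (open_region c) (fun z => (`|phi (a z)| `^ q)%:E).
  apply/measurable_EFinP/measurable_funTS/measurable_norm_powR.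
  exact: (intble_measurable ia).
have muq : measurable_fun setT (fun z => `|u z| `^ q).
  exact: measurable_norm_powR.
have le1 : (\int[rho]_z (`|u z| `^ q)%:E <= (mass c `^ (1 - q))%:E)%E.
  have -> : (\int[rho]_z (`|u z| `^ q)%:E =
      \int[rho]_(z in open_region c) (`|phi (a z)| `^ q)%:E)%E.
    rewrite [RHS]integral_mkcond; apply: eq_integral => z _.
    rewrite patchE /u indicE; case: (z \in open_region c).
      by rewrite mulr1.
    by rewrite mulr0 normr0 powR0// gt_eqF.
  apply: le_trans ((atom_sizeP c a).1 sa); apply: ge0_le_integral => //.
  - apply/measurable_EFinP/measurable_funTS.
    exact: measurable_cmod_powR.
  - move=> z _; rewrite lee_fin; apply: ge0_ler_powR; rewrite ?nnegrE//.
    + exact: ltW.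
    + exact: cmod_ge0.
have iuq : intble rho (fun z => `|u z| `^ q).
  apply/integrableP; split; first exact/measurable_EFinP.
  under eq_integral do rewrite /= ger0_norm ?powR_ge0//.
  by apply: le_lt_trans le1 _; rewrite ltry.
exists u; split => //; exists c => //; split => //.
- move=> z zc; rewrite /u indicE memNset ?mulr0// => /open_region_sub.
  by move=> /(_ L0).
- rewrite -lee_fin /Int /Rintegral fineK//.
  exact: (integrable_fin_num measurableT iuq).
- rewrite -[RHS]Ia; congr fine; apply: ae_eq_integral => //.
  + exact/measurable_EFinP.
  + exact: (measurable_int _ ia).
  + by apply: filterS au => z h _; rewrite /= h.
Qed.

End tree.

(** The mean of the q-th power of the modulus is at most the q-th power of its essential bound. *)
Lemma ooatom_qatom a : atom beta +oo%E a -> atom beta q%:E a.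
Proof.
move=> [La [Q [/admissible_open_region[alpha [L [c [L0 okc QE]]]] a0 sa Ia]]].
split => //; exists Q; split => //; first by rewrite QE; exact: open_region_admissible.
have m0 := mass_gt0 alpha L0 c.
have mO : measurable (open_region alpha L c) by exact: measurable_open_region.
have rO : rho (open_region alpha L c) = (fine (rho (region alpha L c)))%:E.
  exact: massE.
have rO0 : (0 < rho (open_region alpha L c))%E by rewrite rO lte_fin.
rewrite QE; apply/(atom_sizeP _ L0); move: sa.
rewrite /atom_size QE inv_massE// Lnorm.unlock ifT; last first.
  apply: lt_le_trans (le_measure _ _ _ (@subsetT _ (open_region alpha L c))).
  - exact: rO0.
  - by rewrite inE.
  - by rewrite inE.
move=> /ess_supP am.
apply: (@le_trans _ _ (\int[rho]_(z in open_region alpha L c)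
    ((fine (rho (region alpha L c)))^-1 `^ q)%:E)%E).
  apply: ae_ge0_le_integral => //.
  - by move=> z _; rewrite lee_fin powR_ge0.
  - apply/measurable_EFinP/measurable_funTS.
    exact: measurable_cmod_powR.
  - by move=> z _; rewrite lee_fin powR_ge0.
  - apply: filterS am => z /= h _; rewrite lee_fin.
    apply: ge0_ler_powR; rewrite ?nnegrE ?invr_ge0 ?(ltW q0) ?(ltW m0)//.
      exact: cmod_ge0.
    by move: h; rewrite lee_fin ger0_norm ?cmod_ge0.
rewrite integral_cst//.
rewrite [X in (_ * X <= _)%E]rO -EFinM lee_fin powRD ?(gt_eqF m0) ?implybT// (powRr1 (ltW m0)) mulrC.
by rewrite -(powR_inv1 (ltW m0)) -powRrM mulN1r.
Qed.

End atoms_and_real_atoms.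

(** * Finite complex combinations and the L^1 norm *)

Section complex_combinations.
Context {R : realType} {d : nat}.
Local Notation T := (axb_space R d).
Local Notation rho := (@rho R d).
Local Notation cmod := (@ComplexField.Normc.normc R).
Implicit Types (f g : T -> R[i]) (l : seq (R[i] * (T -> R[i]))).

Lemma ComplexE (a b : R) :
  Complex a b = Complex 1 0 * Complex a 0 + Complex 0 1 * Complex b 0.
Proof. by apply/eqP; rewrite eq_complex /=; apply/andP; split; apply/eqP; ring. Qed.

Lemma ComplexD (a b : R) : Complex (a + b) 0 = Complex a 0 + Complex b 0.
Proof. by apply/eqP; rewrite eq_complex /= addr0 !eqxx. Qed.

Definition cweight l : R := \sum_(p <- l) cmod p.1.

Lemma cweight_cat l l' : cweight (l ++ l') = cweight l + cweight l'.
Proof. by rewrite /cweight big_cat. Qed.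

Lemma cweight_cons p l : cweight (p :: l) = cmod p.1 + cweight l.
Proof. by rewrite /cweight big_cons. Qed.

Lemma cweight_ge0 l : 0 <= cweight l.
Proof. by apply: sumr_ge0 => p _; exact: cmod_ge0. Qed.

Lemma comb_cons p l z : comb (p :: l) z = p.1 * p.2 z + comb l z.
Proof. by rewrite /comb big_cons. Qed.

(** Used with [c] equal to 1 or the imaginary unit, which preserves weights. *)
Definition lift (c : R[i]) (l : seq (R * (T -> R))) :
    seq (R[i] * (T -> R[i])) :=
  [seq (c * Complex p.1 0, fun z => Complex (p.2 z) 0) | p <- l].

Lemma comb_lift c (l : seq (R * (T -> R))) z :
  comb (lift c l) z = c * Complex (comb l z) 0.
Proof.
elim: l => [|p l IH]; first by rewrite !comb_nil mulr0.
rewrite /= comb_cons IH /= /comb big_cons -/(comb l z) -mulrA -mulrDr.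
by congr (_ * _); rewrite /GRing.mul /GRing.add /= !mulr0 !mul0r subr0 !addr0.
Qed.

Lemma cweight_lift c (l : seq (R * (T -> R))) :
  cmod c = 1 -> cweight (lift c l) = weight l.
Proof.
move=> c1; rewrite /cweight /weight big_map; apply: eq_bigr => p _ /=.
by rewrite ComplexField.Normc.normcM c1 mul1r cmod_real.
Qed.

Lemma Forall_lift (P : (T -> R) -> Prop) (Q : (T -> R[i]) -> Prop) c
    (l : seq (R * (T -> R))) :
  (forall b, P b -> Q (fun z => Complex (b z) 0)) ->
  List.Forall (fun p => P p.2) l -> List.Forall (fun p => Q p.2) (lift c l).
Proof.
move=> PQ; elim: l => [|p l IH] /=; first by constructor.
by move=> /List.Forall_cons_iff[Pp /IH h]; constructor => //; exact: PQ.
Qed.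

Definition L1norm f : \bar R := (\int[rho]_z (cmod (f z))%:E)%E.

Let mcmod f : L1 f -> measurable_fun setT (fun z => (cmod (f z))%:E).
Proof. by move=> Lf; apply/measurable_EFinP; exact: measurable_cmod. Qed.

Lemma L1norm_ge0 f : (0 <= L1norm f)%E.
Proof. by apply: integral_ge0 => z _; rewrite lee_fin cmod_ge0. Qed.

Lemma L1D f g : L1 f -> L1 g -> L1 (fun z => f z + g z).
Proof.
move=> [rf if_] [rg ig]; split.
  have -> : (fun z => complex.Re (f z + g z)) =
      (fun z => complex.Re (f z)) \+ (fun z => complex.Re (g z)).
    by apply/funext => z /=; case: (f z); case: (g z).
  exact: intbleD.
have -> : (fun z => complex.Im (f z + g z)) =
    (fun z => complex.Im (f z)) \+ (fun z => complex.Im (g z)).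
  by apply/funext => z /=; case: (f z); case: (g z).
exact: intbleD.
Qed.

Lemma L1Z c f : L1 f -> L1 (fun z => c * f z).
Proof.
move=> [rf if_]; case: c => a b; split.
  have -> : (fun z => complex.Re (Complex a b * f z)) =
      (fun z => a * complex.Re (f z)) \- (fun z => b * complex.Im (f z)).
    by apply/funext => z /=; case: (f z).
  by apply: intbleB; exact: intbleZ.
have -> : (fun z => complex.Im (Complex a b * f z)) =
    (fun z => a * complex.Im (f z)) \+ (fun z => b * complex.Re (f z)).
  by apply/funext => z /=; case: (f z).
by apply: intbleD; exact: intbleZ.
Qed.

Lemma L1_0 : L1 (fun=> 0 : R[i]) (d := d).
Proof. by split; exact: intble0. Qed.

Lemma L1_comb l : List.Forall (fun p => L1 p.2) l -> L1 (comb l).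
Proof.
elim: l => [_|p l IH /List.Forall_cons_iff[Lp /IH Ll]].
  by rewrite (_ : comb [::] = fun=> 0); [exact: L1_0|apply/funext => z; rewrite comb_nil].
rewrite (_ : comb (p :: l) = fun z => p.1 * p.2 z + comb l z).
  by apply: L1D => //; exact: L1Z.
by apply/funext => z; rewrite comb_cons.
Qed.

Lemma L1normD f g : L1 f -> L1 g ->
  (L1norm (fun z => (f z + g z)%R) <= L1norm f + L1norm g)%E.
Proof.
move=> Lf Lg; rewrite /L1norm -ge0_integralD//; last 4 first.
- by move=> z _; rewrite lee_fin cmod_ge0.
- exact: mcmod.
- by move=> z _; rewrite lee_fin cmod_ge0.
- exact: mcmod.
apply: ge0_le_integral => //.
- by move=> z _; rewrite lee_fin cmod_ge0.
- by apply: mcmod; exact: L1D.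
- by apply: emeasurable_funD; exact: mcmod.
- by move=> z _; rewrite -EFinD lee_fin cmod_triangle.
Qed.

Lemma L1normZ c f : L1 f ->
  L1norm (fun z => c * f z) = ((cmod c)%:E * L1norm f)%E.
Proof.
move=> Lf; rewrite /L1norm -ge0_integralZl//; last 3 first.
- exact: mcmod.
- by move=> z _; rewrite lee_fin cmod_ge0.
- by rewrite lee_fin cmod_ge0.
by apply: eq_integral => z _; rewrite ComplexField.Normc.normcM.
Qed.

Lemma L1norm_ae f g : L1 f -> L1 g -> {ae rho, forall z, f z = g z} ->
  L1norm f = L1norm g.
Proof.
move=> Lf Lg fg; apply: ae_eq_integral => //; [exact: mcmod|exact: mcmod|].
by apply: filterS fg => z h _; rewrite h.
Qed.

Lemma L1norm_comb l (M : R) :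
  List.Forall (fun p => L1 p.2 /\ (L1norm p.2 <= M%:E)%E) l ->
  (L1norm (comb l) <= (M * cweight l)%:E)%E.
Proof.
elim: l => [_|p l IH /List.Forall_cons_iff[[Lp Np] h]].
  rewrite /L1norm; under eq_integral do rewrite comb_nil cmod0.
  by rewrite integral0 /cweight big_nil mulr0.
have Ll : L1 (comb l) by apply: L1_comb; apply: List.Forall_impl h => ? [].
rewrite (_ : comb (p :: l) = fun z => p.1 * p.2 z + comb l z); last first.
  by apply/funext => z; rewrite comb_cons.
apply: (le_trans (L1normD (L1Z _ Lp) Ll)).
rewrite L1normZ// cweight_cons mulrDr EFinD leeD//; last exact: IH.
by rewrite mulrC EFinM lee_wpmul2l// lee_fin cmod_ge0.
Qed.

End complex_combinations.

(** * Decomposition of complex atoms and of finite combinations *)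

Section complex_atoms.
Context {R : realType} {d : nat}.
Variables (beta q : R).
Hypotheses (hd : (0 < d)%N) (hbeta : 1 + ln 2 < beta) (q1 : 1 < q).
Local Notation T := (axb_space R d).
Local Notation rho := (@rho R d).
Local Notation cmod := (@ComplexField.Normc.normc R).
Implicit Types (a b f : T -> R[i]) (l : seq (R[i] * (T -> R[i]))).

Let B1 : 1 < 2 ^+ d :> R.
Proof. by rewrite exprn_egt1 ?ltr1n// -lt0n. Qed.

Lemma atom_real_parts b : atom beta q%:E b ->
  exists alpha L u v, [/\ 0 < L,
    real_qatom rho (region alpha L) (admissible_cell beta alpha L) q u,
    real_qatom rho (region alpha L) (admissible_cell beta alpha L) q v &
    {ae rho, forall z, b z = Complex (u z) (v z)}].
Proof.
move=> [Lb [Q [/admissible_open_region[alpha [L [c [L0 okc ->]]]] b0 sb Ib]]].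
have [rb ib] := Lb; move: Ib => /eqP; rewrite eq_complex => /andP[/eqP Ir /eqP Ii].
have [u [qu eu]] := real_part_of_atom q1 L0 okc Lb b0 sb (@normr_Re_le R) rb Ir.
have [v [qv ev]] := real_part_of_atom q1 L0 okc Lb b0 sb (@normr_Im_le R) ib Ii.
exists alpha, L, u, v; split => //.
by apply: filterS2 eu ev => z <- <-; case: (b z).
Qed.

(** Real and imaginary parts contribute 1 each. A uniform bound is all that is needed to turn
    weights into L^1 errors. *)
Lemma atom_L1norm_le2 b : atom beta q%:E b -> L1 b /\ (L1norm b <= 2%:E)%E.
Proof.
move=> ab; have [Lb _] := ab; split => //.
have [alpha [L [u [v [L0 qu qv buv]]]]] := atom_real_parts ab.
have S := cell_subdivision alpha hd hbeta L0.
have iu := real_qatom_intble q1 L0 qu; have iv := real_qatom_intble q1 L0 qv.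
have nu : Int rho (fun z => `|u z|) <= 1.
  by move: qu => [P okP [mu_ u0 iuq uq _]]; exact: (qatom_norm_le1 S q1 okP mu_ u0 iuq uq).
have nv : Int rho (fun z => `|v z|) <= 1.
  by move: qv => [P okP [mu_ u0 iuq uq _]]; exact: (qatom_norm_le1 S q1 okP mu_ u0 iuq uq).
have iau := intble_norm iu; have iav := intble_norm iv.
have isum := intbleD iau iav.
apply: (@le_trans _ _ (\int[rho]_z (`|u z| + `|v z|)%:E)%E).
  apply: ae_ge0_le_integral => //.
  - by move=> z _; rewrite lee_fin cmod_ge0.
  - by apply/measurable_EFinP; exact: measurable_cmod.
  - exact: (measurable_int _ isum).
  - by apply: filterS buv => z -> _; rewrite lee_fin; exact: (cmod_le_ReIm (Complex _ _)).
have -> : (\int[rho]_z (`|u z| + `|v z|)%:E =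
    (Int rho ((fun z => `|u z|) \+ (fun z => `|v z|)))%:E)%E.
  by rewrite /Int /Rintegral fineK//; exact: (integrable_fin_num measurableT isum).
by rewrite lee_fin IntD//; lra.
Qed.

(** The outer factor 2 is for real and imaginary parts; the last [2 ^+ d], the mass ratio [B], is
    the weight of the bounded part of the stopping-time decomposition. *)
Definition atom_const : R := 2 * (cz_const (2 ^+ d) q + 2 ^+ d).

Lemma atom_const_gt0 : 0 < atom_const.
Proof.
by rewrite mulr_gt0// ltr_wpDl ?exprn_gt0//; exact: cz_const_ge0.
Qed.

Lemma atom_decomposition b eps : atom beta q%:E b -> 0 < eps ->
  exists l l', [/\ {ae rho, forall z, b z = comb l z + comb l' z},
    List.Forall (fun p => atom beta +oo%E p.2) l,
    List.Forall (fun p => atom beta q%:E p.2) l' &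
    cweight l <= atom_const /\ cweight l' <= eps].
Proof.
move=> ab e0; have [alpha [L [u [v [L0 qu qv buv]]]]] := atom_real_parts ab.
have S := cell_subdivision alpha hd hbeta L0.
have e2 : 0 < eps / 2 by rewrite divr_gt0.
have D w : real_qatom rho (region alpha L) (admissible_cell beta alpha L) q w ->
  exists l l' : seq (R * (T -> R)), [/\ forall z, w z = comb l z + comb l' z,
    List.Forall (fun p => real_ooatom rho (region alpha L)
      (admissible_cell beta alpha L) p.2) l,
    List.Forall (fun p => real_qatom rho (region alpha L)
      (admissible_cell beta alpha L) q p.2) l' &
    weight l <= cz_const (2 ^+ d) q + 2 ^+ d /\ weight l' <= eps / 2].
  move=> [P okP [mw w0 iwq wq Iw]].
  apply: (real_atom_decomposition S q1 okP mw w0 iwq wq B1 _ Iw e2) => A.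
  exact: (settled_measurable hd hbeta L0 okP).
have [l1 [l1' [E1 o1 o1' [w1 w1']]]] := D _ qu.
have [l2 [l2' [E2 o2 o2' [w2 w2']]]] := D _ qv.
have c1 : cmod (Complex 1 0) = 1 by rewrite cmod_real normr1.
have ci : cmod (Complex 0 1) = 1 by rewrite cmod_imag normr1.
exists (lift (Complex 1 0) l1 ++ lift (Complex 0 1) l2),
  (lift (Complex 1 0) l1' ++ lift (Complex 0 1) l2'); split.
- apply: filterS buv => z ->; rewrite E1 E2 !comb_cat !comb_lift.
  rewrite ComplexE (ComplexD (comb l1 z)) (ComplexD (comb l2 z)); ring.
- by apply/List.Forall_app; split; apply: Forall_lift;
    [exact: (real_ooatom_atom L0)|..|exact: (real_ooatom_atom L0)|].
- by apply/List.Forall_app; split; apply: Forall_lift;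
    [exact: (real_qatom_atom q1 L0)|..|exact: (real_qatom_atom q1 L0)|].
split; rewrite cweight_cat !cweight_lift//.
  by rewrite /atom_const; lra.
by rewrite (splitr eps) lerD.
Qed.

Lemma list_decomposition r : List.Forall (fun p => atom beta q%:E p.2) r ->
  exists l l', [/\ {ae rho, forall z, comb r z = comb l z + comb l' z},
    List.Forall (fun p => atom beta +oo%E p.2) l,
    List.Forall (fun p => atom beta q%:E p.2) l',
    cweight l <= atom_const * cweight r & cweight l' <= cweight r / 2].
Proof.
elim: r => [_|[c b] r IH /List.Forall_cons_iff[/= ab /IH]].
  exists [::], [::]; split => //.
  - by apply: aeW => z; rewrite !comb_nil addr0.
  - by rewrite /cweight !big_nil mulr0.
  - by rewrite /cweight !big_nil mul0r.
move=> [l1 [l1' [e1 o1 q1' w1 w1']]].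
(* Remainder 1/2 per atom makes the weight of any item decay geometrically under repetition. *)
have h2 : 0 < 1 / 2 :> R by rewrite divr_gt0.
have [l2 [l2' [e2 o2 q2' [w2 w2']]]] := atom_decomposition ab h2.
pose scale (l : seq (R[i] * (T -> R[i]))) := [seq (c * p.1, p.2) | p <- l].
have scE l z : comb (scale l) z = c * comb l z.
  by rewrite /comb big_map big_distrr/=; apply: eq_bigr => p _; rewrite mulrA.
have scW l : cweight (scale l) = cmod c * cweight l.
  rewrite /cweight big_map big_distrr/=; apply: eq_bigr => p _.
  exact: ComplexField.Normc.normcM.
have scF (P : (T -> R[i]) -> Prop) l : List.Forall (fun p => P p.2) l ->
    List.Forall (fun p => P p.2) (scale l).
  elim: l => [|p l IHl] /=; first by constructor.
  by move=> /List.Forall_cons_iff[Pp /IHl h]; constructor.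
exists (scale l2 ++ l1), (scale l2' ++ l1'); split.
- apply: filterS2 e1 e2 => z h1 h2'.
  by rewrite comb_cons /= h1 h2' !comb_cat !scE; ring.
- by apply/List.Forall_app; split => //; exact: scF.
- by apply/List.Forall_app; split => //; exact: scF.
- rewrite cweight_cat scW cweight_cons mulrDr lerD// mulrC.
  by rewrite ler_wpM2r// cmod_ge0.
- rewrite cweight_cat scW cweight_cons mulrDl lerD//.
  by rewrite ler_wpM2l ?cmod_ge0// -div1r.
Qed.

End complex_atoms.

(** * From (1,q)- to (1,oo)-decompositions *)

Lemma nondecreasing_tail {R : realType} (u : nat -> R) (M eps : R) :
  nondecreasing_seq u -> (forall n, u n <= M) -> 0 < eps ->
  exists k0, forall k n, (k0 <= k)%N -> (k <= n)%N -> u n - u k <= eps.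
Proof.
move=> nd uM e0.
have cu : cvgn u.
  by apply: nondecreasing_is_cvgn => //; exists M => _ [n _ <-].
have := cu => /cvgrPdist_le /(_ _ e0)[k0 _ h].
exists k0 => k n k0k kn; have := h k k0k.
have un := nondecreasing_cvgn_le nd cu n.
by rewrite ger0_norm ?subr_ge0; [lra|exact: nondecreasing_cvgn_le].
Qed.

Lemma ge0_cvge0P {R : realType} (X : nat -> \bar R) : (forall n, 0 <= X n)%E ->
  (X @ \oo --> 0%E <-> forall eps, 0 < eps ->
    exists N, forall n, (N <= n)%N -> (X n <= eps%:E)%E).
Proof.
move=> X0; split.
  move=> /fine_cvgP[[N1 _ fN1] /cvgrPdist_le h] eps e0.
  have [N2 _ hN2] := h _ e0; exists (maxn N1 N2) => n.
  rewrite geq_max => /andP[/fN1 /= fX /hN2 /=].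
  by rewrite sub0r normrN ger0_norm ?fine_ge0// -lee_fin fineK.
move=> h; apply/fine_cvgP; split.
  have [N hN] := h 1 ltr01; exists N => // n /= /hN Xn.
  by rewrite ge0_fin_numE// (le_lt_trans Xn) ?ltry.
apply/cvgrPdist_le => e e0; have [N hN] := h _ e0; exists N => // n /= /hN Xn.
rewrite sub0r normrN ger0_norm ?fine_ge0// -lee_fin fineK//.
by rewrite ge0_fin_numE// (le_lt_trans Xn) ?ltry.
Qed.

Section global_decomposition.
Context {R : realType} {d : nat}.
Variables (beta q : R).
Hypotheses (hd : (0 < d)%N) (hbeta : 1 + ln 2 < beta) (q1 : 1 < q).
Local Notation T := (axb_space R d).
Local Notation rho := (@rho R d).
Local Notation cmod := (@ComplexField.Normc.normc R).
Local Notation K := (@atom_const R d q).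
Local Notation list := (seq (R[i] * (T -> R[i]))).
Local Notation qatoms := (List.Forall (fun p => atom beta q%:E p.2)).
Local Notation ooatoms := (List.Forall (fun p => atom beta +oo%E p.2)).

Variables (f : T -> R[i]) (lambda : nat -> R[i]) (b : nat -> T -> R[i]).
Hypotheses (Lf : L1 f) (fb : atomic_decomposition beta q%:E f lambda b).

(** The null items that open the blocks must be atoms; the admissible set is borrowed from [b 0]. *)
Let zero_atom : atom beta +oo%E (fun _ : T => 0 : R[i]).
Proof.
have [ab _ _] := fb; have [_ [Q [aQ _ _ _]]] := ab 0%N.
split; first exact: L1_0.
exists Q; split => //; first exact: aeW.
- rewrite /atom_size Lnorm.unlock; case: ifP => _; last first.
    by rewrite inve_ge0 measure_ge0.
  apply/ess_supP; apply: aeW => z /=.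
  by rewrite expr0n /= addr0 sqrtr0 normr0 inve_ge0 measure_ge0.
- by rewrite /cintegral -!/(Int _ _) !Int0.
Qed.

(** Lists not made of (1,q)-atoms get a dummy value, so that choice yields a function on all
    lists. *)
Let step_ex : exists step : list -> list * list, forall r, qatoms r ->
  [/\ {ae rho, forall z, comb r z = comb (step r).1 z + comb (step r).2 z},
    ooatoms (step r).1, qatoms (step r).2,
    cweight (step r).1 <= K * cweight r &
    cweight (step r).2 <= cweight r / 2].
Proof.
have h r : exists s : list * list, qatoms r ->
    [/\ {ae rho, forall z, comb r z = comb s.1 z + comb s.2 z},
    ooatoms s.1, qatoms s.2, cweight s.1 <= K * cweight r &
    cweight s.2 <= cweight r / 2].
  have [qr|qr] := pselect (qatoms r); last by exists ([::], [::]) => /qr.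
  have [l [l' H]] := list_decomposition hd hbeta q1 qr.
  by exists (l, l').
by have [step hstep] := choice h; exists step.
Qed.

Let step := projT1 (cid step_ex).
Let stepP r : qatoms r ->
  [/\ {ae rho, forall z, comb r z = comb (step r).1 z + comb (step r).2 z},
    ooatoms (step r).1, qatoms (step r).2,
    cweight (step r).1 <= K * cweight r &
    cweight (step r).2 <= cweight r / 2].
Proof. exact: (projT2 (cid step_ex)). Qed.

(** Repeated decomposition of each atom separately would give a double series. Here stage [k] joins
    the [k]-th item to what is left of all earlier ones and processes this finite list once. *)
Let Fixpoint residual k : list :=
  if k is k'.+1 then (step ((lambda k', b k') :: residual k')).2 else [::].

Let block k : list := (0, fun=> 0) :: (step ((lambda k, b k) :: residual k)).1.

Let blocks n : list := flatten [seq block k | k <- iota 0 n].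

Let residual_qatoms k : qatoms (residual k).
Proof.
elim: k => [|k IH] /=; first by constructor.
have [ab _ _] := fb.
have qk : qatoms ((lambda k, b k) :: residual k) by constructor; [exact: ab|].
by have [] := stepP qk.
Qed.

Let current_qatoms k : qatoms ((lambda k, b k) :: residual k).
Proof. by have [ab _ _] := fb; constructor; [exact: ab|]. Qed.

Let blocksS n : blocks n.+1 = blocks n ++ block n.
Proof. by rewrite /blocks -addn1 iotaD map_cat flatten_cat /= add0n cats0. Qed.

Let blocks_ooatoms n : ooatoms (blocks n).
Proof.
elim: n => [|n IH]; first by constructor.
rewrite blocksS; apply/List.Forall_app; split => //; constructor => //.
by have [] := stepP (current_qatoms n).
Qed.

Let blocks_prefix m n : (m <= n)%N ->
  exists l : list, blocks n = blocks m ++ l.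
Proof.
move=> /subnK <-; elim: (n - m)%N => [|k [l IH]].
  by exists [::]; rewrite cats0.
by exists (l ++ block (k + m)); rewrite addSn blocksS IH catA.
Qed.

Let size_blocks n : (n <= size (blocks n))%N.
Proof.
elim: n => // n IH; rewrite blocksS size_cat /= addnS ltnS.
by rewrite (leq_trans IH)// leq_addr.
Qed.

Let partial n : R := \sum_(k < n) cmod (lambda k).
Let mass n : R := \sum_(k < n) cweight ((lambda k, b k) :: residual k).

(* Each item at most halves its weight at every step, so the residuals have
   summable weights. *)
Let mass_le n : mass n + 2 * cweight (residual n) <= 2 * partial n.
Proof.
elim: n => [|n IH].
  by rewrite /mass /partial !big_ord0 /cweight big_nil; lra.
rewrite /mass /partial !big_ord_recr /= -/(mass n) -/(partial n).
have [_ _ _ _ h] := stepP (current_qatoms n).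
rewrite cweight_cons /= in h *; lra.
Qed.

Let massS n : mass n.+1 = mass n + (cmod (lambda n) + cweight (residual n)).
Proof. by rewrite /mass big_ord_recr /= cweight_cons. Qed.

Let blocks_weight n : cweight (blocks n) <= K * mass n.
Proof.
elim: n => [|n IH].
  by rewrite /mass big_ord0 mulr0 /cweight big_nil.
rewrite blocksS cweight_cat /mass big_ord_recr /= -/(mass n) mulrDr lerD//.
have [_ _ _ h _] := stepP (current_qatoms n).
by rewrite /block [leLHS]cweight_cons /= expr0n addr0 sqrtr0 add0r.
Qed.

Let total : R := fine (\sum_(0 <= j <oo) (cmod (lambda j))%:E)%E.

Let totalE : (\sum_(0 <= j <oo) (cmod (lambda j))%:E)%E = total%:E.
Proof.
have [_ sum_lt _] := fb; rewrite fineK// ge0_fin_numE//.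
by apply: nneseries_ge0 => j _ _; rewrite lee_fin cmod_ge0.
Qed.

Let partial_le n : partial n <= total.
Proof.
rewrite -lee_fin -totalE /partial -sumEFin -(big_mkord xpredT (fun j => (cmod (lambda j))%:E)).
by apply: nneseries_lim_ge => j _ _; rewrite lee_fin cmod_ge0.
Qed.

Let mass_le_total n : mass n <= 2 * total.
Proof.
have := mass_le n; have := partial_le n; have := cweight_ge0 (residual n); lra.
Qed.

Let blocks_weight_le n : cweight (blocks n) <= 2 * K * total.
Proof.
apply: (le_trans (blocks_weight n)).
by rewrite -[leRHS]mulrA [leRHS]mulrCA ler_pM2l ?mass_le_total// atom_const_gt0.
Qed.

Let telescope n : {ae rho, forall z,
  \sum_(j < n) lambda j * b j z = comb (blocks n) z + comb (residual n) z}.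
Proof.
elim: n => [|n IH].
  by apply: aeW => z; rewrite big_ord0 /= !comb_nil addr0.
have [h _ _ _ _] := stepP (current_qatoms n).
apply: filterS2 IH h => z h1 h2.
rewrite big_ord_recr /= h1 blocksS comb_cat comb_cons mul0r add0r.
by rewrite -!addrA; congr (_ + _); rewrite -h2 comb_cons addrC.
Qed.

(* Each block starts with a null item, so that blocks j.+1 has more than j items. *)
Let seqatom j := nth (0, fun=> 0) (blocks j.+1) j.

Let seqatom_sum n : forall z,
  \sum_(j < n) (seqatom j).1 * (seqatom j).2 z = comb (take n (blocks n)) z.
Proof.
move=> z; rewrite /comb (big_nth (0, fun=> 0)) size_takel// big_mkord.
apply: eq_bigr => j _; rewrite nth_take//.
have [l ->] := blocks_prefix (ltn_ord j).
by rewrite nth_cat size_blocks.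
Qed.

Let coef j := (seqatom j).1.
Let atm j := (seqatom j).2.

Let atm_ooatom j : atom beta +oo%E (atm j).
Proof.
rewrite /atm /seqatom; have := blocks_ooatoms j.+1; move: (blocks _) => l.
elim: l j => [|p l IH] [|j] //=; try by move=> _; exact: zero_atom.
  by move=> /List.Forall_cons_iff[].
by move=> /List.Forall_cons_iff[_ /IH].
Qed.

Let cweight_take n (l : list) : cweight (take n l) <= cweight l.
Proof.
by rewrite -[in leRHS](cat_take_drop n l) cweight_cat lerDl cweight_ge0.
Qed.

Let coef_sum n : \sum_(j < n) cmod (coef j) = cweight (take n (blocks n)).
Proof.
rewrite /cweight (big_nth (0, fun=> 0)) size_takel// big_mkord.
apply: eq_bigr => j _; rewrite nth_take//.
have [l ->] := blocks_prefix (ltn_ord j).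
by rewrite nth_cat size_blocks.
Qed.

Let coef_series : (\sum_(0 <= j <oo) (cmod (coef j))%:E <= (2 * K * total)%:E)%E.
Proof.
apply: lime_le.
  by apply: is_cvg_nneseries => j _ _; rewrite lee_fin cmod_ge0.
apply: nearW => n; rewrite big_mkord sumEFin lee_fin coef_sum.
exact: le_trans (cweight_take _ _) (blocks_weight_le n).
Qed.

Let Fn n z := \sum_(j < n) lambda j * b j z.

Let ooL1 (l : list) : ooatoms l -> List.Forall
  (fun p => L1 p.2 /\ (L1norm p.2 <= 2%:E)%E) l.
Proof.
apply: List.Forall_impl => p /(ooatom_qatom q1).
exact: atom_L1norm_le2.
Qed.

Let qL1 (l : list) : qatoms l -> List.Forall
  (fun p => L1 p.2 /\ (L1norm p.2 <= 2%:E)%E) l.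
Proof. by apply: List.Forall_impl => p; exact: atom_L1norm_le2. Qed.

Let L1_of (l : list) :
  List.Forall (fun p => L1 p.2 /\ (L1norm p.2 <= 2%:E)%E) l -> L1 (comb l).
Proof. by move=> h; apply: L1_comb; apply: List.Forall_impl h => ? []. Qed.

Let L1Fn n : L1 (Fn n).
Proof.
have [ab _ _] := fb.
pose l := [seq (lambda j, b j) | j <- iota 0 n].
have -> : Fn n = comb l.
  apply/funext => z; rewrite /comb big_map /Fn -(big_mkord xpredT (fun j => lambda j * b j z)).
  by rewrite /index_iota subn0.
apply: L1_comb; rewrite /l; elim: (iota 0 n) => [|j s IH] /=; first by constructor.
by constructor => //; have [] := ab j.
Qed.

Let L1sub (g h : T -> R[i]) : L1 g -> L1 h -> L1 (fun z => g z - h z).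
Proof.
move=> Lg Lh; have := L1D Lg (L1Z (-1) Lh).
by under eq_fun do rewrite mulN1r.
Qed.

Let L1norm_residual k :
  (L1norm (comb (residual k)) <= (2 * cweight (residual k))%:E)%E.
Proof. exact/L1norm_comb/qL1/residual_qatoms. Qed.

(** By [telescope], the error is [f - Fn k], plus the residual of stage [k], minus the items after
    [blocks k] up to position [n], which may lie inside a block. Atoms have L^1 norm at most 2. *)
Let approx_bound k n (l : list) : blocks n = blocks k ++ l ->
  (size (blocks k) <= n)%N ->
  (L1norm (fun z => f z - \sum_(j < n) coef j * atm j z)%R <=
   L1norm (fun z => f z - Fn k z)%R +
   (2 * cweight (residual k) + 2 * (cweight (blocks n) - cweight (blocks k)))%:E)%E.
Proof.
move=> nk kn; have ok := blocks_ooatoms k; have on := blocks_ooatoms n.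
have takeE : take n (blocks n) = blocks k ++ take (n - size (blocks k)) l.
  by rewrite nk take_cat ltnNge kn.
pose l' := take (n - size (blocks k)) l.
have ol' : ooatoms l'.
  move: on; rewrite nk => /List.Forall_app[_].
  by rewrite -{1}(cat_take_drop (n - size (blocks k)) l) => /List.Forall_app[].
have wl' : cweight l' <= cweight (blocks n) - cweight (blocks k).
  by rewrite nk cweight_cat addrAC subrr add0r cweight_take.
have LL := L1sub Lf (L1Fn k).
have Lr := L1_of (qL1 (residual_qatoms k)).
have Ll := L1_of (ooL1 ol').
have Lb := L1_of (ooL1 ok).
have Lr' := L1Z (-1) Ll.
have -> : L1norm (fun z => f z - \sum_(j < n) coef j * atm j z) =
    L1norm (fun z => (f z - Fn k z) + (comb (residual k) z + -1 * comb l' z)).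
  apply: L1norm_ae.
  - have -> : (fun z => f z - \sum_(j < n) coef j * atm j z) =
        (fun z => f z - comb (blocks k ++ l') z).
      by apply/funext => z; rewrite -takeE -seqatom_sum.
    apply: L1sub => //; apply: L1_of; apply: ooL1.
    by apply/List.Forall_app.
  - by apply: L1D => //; exact: L1D.
  - apply: filterS (telescope k) => z h.
    rewrite /Fn h.
    rewrite (_ : \sum_(j < n) coef j * atm j z = comb (blocks k ++ l') z).
      by rewrite comb_cat; ring.
    by rewrite -takeE -seqatom_sum.
apply: (le_trans (L1normD LL (L1D Lr Lr'))); rewrite leeD2l//.
apply: (le_trans (L1normD Lr Lr')); rewrite EFinD leeD//.
rewrite L1normZ// (_ : cmod (-1) = 1); last first.
  rewrite /= -[LHS]/(Num.sqrt ((-1) ^+ 2 + (- 0) ^+ 2)).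
  by rewrite oppr0 expr0n /= addr0 sqrrN expr1n sqrtr1.
rewrite mul1e; apply: (le_trans (L1norm_comb (ooL1 ol'))).
by rewrite lee_fin ler_pM2l.
Qed.

Lemma ooatom_decomposition_exists : exists lambda' b',
  atomic_decomposition beta +oo%E f lambda' b' /\
  (\sum_(0 <= j <oo) (cmod (lambda' j))%:E <=
    (2 * K)%:E * \sum_(0 <= j <oo) (cmod (lambda j))%:E)%E.
Proof.
exists coef, atm; split; last by rewrite totalE -EFinM; exact: coef_series.
split => //; first by apply: le_lt_trans coef_series _; rewrite ltry.
have [_ _ fF] := fb.
have {}fF := (ge0_cvge0P (fun n => L1norm_ge0 _)).1 fF.
apply/(ge0_cvge0P (fun n => L1norm_ge0 _)) => eps e0.
(* One share for the error of the given decomposition, two for the residual and two for the later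
   items, both counted with the factor 2 of the L^1 norm of atoms. *)
have e5 : 0 < eps / 5 by rewrite divr_gt0.
have [k1 h1] := fF _ e5.
have massnd : nondecreasing_seq mass.
  by apply/nondecreasing_seqP => n; rewrite massS lerDl addr_ge0 ?cmod_ge0 ?cweight_ge0.
have blnd : nondecreasing_seq (fun n => cweight (blocks n)).
  by apply/nondecreasing_seqP => n; rewrite blocksS cweight_cat lerDl cweight_ge0.
have [k2 h2] := nondecreasing_tail massnd mass_le_total e5.
have [k3 h3] := nondecreasing_tail blnd blocks_weight_le e5.
pose k := maxn k1 (maxn k2 k3).
have kk1 : (k1 <= k)%N by rewrite leq_maxl.
have kk2 : (k2 <= k)%N by rewrite (leq_trans (leq_maxl k2 k3))// leq_maxr.
have kk3 : (k3 <= k)%N by rewrite (leq_trans (leq_maxr k2 k3))// leq_maxr.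
exists (size (blocks k)) => n kn.
have kn' : (k <= n)%N by rewrite (leq_trans (size_blocks k)).
have [l nk] := blocks_prefix kn'.
apply: (le_trans (approx_bound nk kn)).
have a1 : (L1norm (fun z => f z - Fn k z)%R <= (eps / 5)%:E)%E by exact: h1.
apply: (le_trans (leeD2r _ a1)); rewrite -EFinD lee_fin.
(* The increment of [mass] at [k] dominates the weight of [residual k]. *)
have := h2 k k.+1 kk2 (leqnSn k); rewrite massS.
have := h3 k n kk3 kn'; have := cmod_ge0 (lambda k); lra.
Qed.

End global_decomposition.

Theorem corollary3p24 (R : realType) (d : nat) (hd : (1 <= d)%N)
    (beta : R) (hbeta : 1 + ln 2 < beta) (q : R) (hq : 1 < q) :
  H1 d beta q%:E = H1 d beta +oo%E /\
  exists c C : R, [/\ 0 < c, 0 < C &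
    forall f, H1 d beta +oo%E f ->
      (c%:E * H1_norm beta +oo f <= H1_norm beta q%:E f)%E /\
      (H1_norm beta q%:E f <= C%:E * H1_norm beta +oo f)%E].
Proof.
have oo_q (f : axb_space R d -> R[i]) lambda b :
    atomic_decomposition beta +oo%E f lambda b ->
    atomic_decomposition beta q%:E f lambda b.
  by move=> [ab s c]; split => // j; exact: ooatom_qatom.
split.
  apply/seteqP; split => f [Lf [lambda [b fb]]]; split => //.
    have [l [b' [fb' _]]] := ooatom_decomposition_exists hd hbeta hq Lf fb.
    by exists l, b'.
  by exists lambda, b; exact: oo_q.
have K0 : 0 < 2 * @atom_const R d q.
  by rewrite mulr_gt0// atom_const_gt0.
(* The lower constant inverts the loss in [ooatom_decomposition_exists]; the upper one is 1 because
   (1,oo)-decompositions are (1,q)-decompositions with the same coefficients. *)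
exists (2 * @atom_const R d q)^-1, 1; split => //; first by rewrite invr_gt0.
move=> f [Lf _]; split.
  apply: le_ereal_inf_tmp => _ [lambda [b [fb ->]]].
  have [l [b' [fb' le_sum]]] := ooatom_decomposition_exists hd hbeta hq Lf fb.
  rewrite lee_pdivrMl//; apply: le_trans le_sum.
  by apply: ereal_inf_lbound; exists l, b'.
rewrite mul1e; apply: le_ereal_inf => _ [lambda [b [fb ->]]].
by exists lambda, b; split => //; exact: oo_q.
Qed.
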